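(* Let $R$ be a finite commutative ring of the form \[ (\mathbb{Z}/2\mathbb{Z})^{k_1} \times (\mathbb{Z}/4\mathbb{Z})^{k_2} \times (\mathbb{Z}/8\mathbb{Z})^{k_3} \times (\mathbb{F}_2[x]/(x^2))^{k_4} \times R', \] where $k_1,k_2,k_3,k_4$ are nonnegative integers and $R'$ is a product of local rings none of which is isomorphic to $\mathbb{Z}/2\mathbb{Z}$, $\mathbb{Z}/4\mathbb{Z}$, $\mathbb{Z}/8\mathbb{Z}$ or $\mathbb{F}_2[x]/(x^2)$. Then \[ D(R) = \max_{0\le a\le k_2 + k_4,\ 0\le b\le k_3}\Big[D\big(U(R') \times C_2^{\,k_2 + k_4 + 2k_3 - a - 2b}\big) + k_1 + 2a + 3b \Big], \] the maximum being over integers $a,b$ in the indicated ranges.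
   Context: Rings are commutative and unital. For a commutative semigroup $S$ with identity, written multiplicatively, a finite sequence $A$ of elements of $S$ has product $\pi(A)$, the empty sequence having product $1$. The sequence $A$ is reducible if there is a proper subsequence $A' \subsetneq A$ (possibly empty) with $\pi(A') = \pi(A)$; otherwise it is irreducible. The Davenport constant $D(S)$ is the minimum positive integer $k$ such that every sequence of $k$ elements of $S$ is reducible (with $D(S)=\infty$ if no such $k$ exists). For a ring $R$, $D(R)$ denotes $D$ of the semigroup of all elements of $R$ under multiplication, and $U(R)$ is the group of units of $R$. $C_n$ is the cyclic group of order $n$. The product of local rings $R'$ may be empty, in which case $R'$ is the zero ring and $U(R')$ is trivial. *)

(* Defs.v *)
From HB Require Import structures.
From mathcomp Require Import all_boot all_order all_algebra all_fingroup.

Set Implicit Arguments.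
Unset Strict Implicit.
Unset Printing Implicit Defensive.

Import GRing.Theory.
Local Open Scope ring_scope.

Section Davenport.
Variables (S : finType) (e : S) (op : Monoid.com_law e).
Implicit Types A : seq S.

Definition seq_prod A : S := \big[op/e]_(x <- A) x.

(* A subsequence is given by the mask of its positions, so that repeated
   terms count with multiplicity; it is proper when a position is dropped. *)
Definition reducible A : bool :=
  [exists m : (size A).-tuple bool,
    (false \in tval m) && (seq_prod (mask m A) == seq_prod A)].

Lemma reducibleP A :
  reflect (exists B, [/\ subseq B A, (size B < size A)%N &
                         seq_prod B = seq_prod A])
          (reducible A).
Proof.
apply: (iffP existsP) => [[m /andP[m0 /eqP mA]]|[B [/subseqP[m sm ->] lt eqB]]].
  exists (mask m A); split=> //; first exact: mask_subseq.
  rewrite size_mask ?size_tuple // -[leqRHS](size_tuple m) ltnNge.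
  rewrite leq_eqVlt ltnNge count_size orbF eq_sym -all_count.
  by apply/negP=> /allP/(_ _ m0).
have sm' : size m == size A by apply/eqP.
exists (Tuple sm') => /=; rewrite eqB eqxx andbT.
apply: contraLR lt => m1; rewrite -leqNgt size_mask // -sm.
rewrite (_ : count id m = size m) //; apply/eqP; rewrite -all_count.
by apply/allP=> -[] // /(negP m1).
Qed.

Definition davenport_bound (k : nat) : bool :=
  (0 < k)%N && [forall A : k.-tuple S, reducible A].

(* For finite S the set of such k is nonempty, so D(S) is never infinite. *)
Lemma davenport_bound_ex : exists k, davenport_bound k.
Proof.
exists #|S|; apply/andP; split; first by apply/card_gt0P; exists e.
apply/forallP=> A; apply/reducibleP.
pose f (i : 'I_#|S|.+1) := seq_prod (take i A).
have /injectivePn[i [j nij eqf]] : ~~ injectiveb f.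
  by apply/injectiveP=> /leq_card; rewrite card_ord ltnn.
wlog lij : i j nij eqf / (i < j)%N.
  move=> W; case: (ltngtP i j) => [||/val_inj eij]; first exact: W.
    by apply: W; rewrite 1?eq_sym.
  by rewrite eij eqxx in nij.
have jA : (j <= size A)%N by rewrite size_tuple -ltnS.
exists (take i A ++ drop j A); split.
- rewrite -[X in subseq _ X](cat_take_drop i A); apply: cat_subseq => //.
  by rewrite -(subnK (ltnW lij)) -drop_drop drop_subseq.
- rewrite size_cat size_drop size_takel ?(leq_trans (ltnW lij)) //.
  by rewrite -[X in (_ < X)%N](subnKC jA) ltn_add2r.
- by rewrite -[in RHS](cat_take_drop j A) /seq_prod !big_cat; congr (op _ _).
Qed.

Definition davenport : nat := ex_minn davenport_bound_ex.

End Davenport.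

(* The library's unit groups exclude the zero ring, which is allowed here. *)
Section UnitGroup.
Variable R : finComPzRingType.

Definition invertible : pred R := fun x => [exists y : R, y * x == 1].

Record unit_group : predArgType :=
  UnitGroup { unit_group_val :> R; _ : invertible unit_group_val }.

HB.instance Definition _ := [isSub for unit_group_val].
HB.instance Definition _ := [Finite of unit_group by <:].

Lemma invertible1 : invertible 1.
Proof. by apply/existsP; exists 1; rewrite mul1r. Qed.

Lemma invertibleM x y : invertible x -> invertible y -> invertible (x * y).
Proof.
move=> /existsP[x' /eqP x'x] /existsP[y' /eqP y'y]; apply/existsP.
by exists (y' * x'); rewrite mulrA -(mulrA y') x'x mulr1 y'y.
Qed.

Definition inverse_of (x : R) : R := odflt 1 [pick y | y * x == 1].

Lemma mul_inverse_of x : invertible x -> inverse_of x * x = 1.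
Proof.
rewrite /inverse_of; case: pickP => [y /eqP //|no /existsP[y]].
by rewrite no.
Qed.

Lemma invertible_inverse x : invertible x -> invertible (inverse_of x).
Proof.
by move=> /mul_inverse_of xV; apply/existsP; exists x; rewrite mulrC xV.
Qed.

Definition unit_group_one := UnitGroup invertible1.
Definition unit_group_mul (u v : unit_group) :=
  UnitGroup (invertibleM (valP u) (valP v)).
Definition unit_group_inv (u : unit_group) :=
  UnitGroup (invertible_inverse (valP u)).

Lemma unit_group_mulA : associative unit_group_mul.
Proof. by move=> u v w; apply: val_inj; rewrite /= mulrA. Qed.
Lemma unit_group_mul1 : left_id unit_group_one unit_group_mul.
Proof. by move=> u; apply: val_inj; rewrite /= mul1r. Qed.
Lemma unit_group_mulV :
  left_inverse unit_group_one unit_group_inv unit_group_mul.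
Proof. by move=> u; apply: val_inj; apply: mul_inverse_of (valP u). Qed.

HB.instance Definition _ := Finite_isGroup.Build unit_group
  unit_group_mulA unit_group_mul1 unit_group_mulV.

End UnitGroup.

(* C_2 is 'Z_2 with its canonical group structure, which is additive. *)
Definition unitsxC2 (R : finComPzRingType) (n : nat) : finGroupType :=
  (unit_group R * {dffun forall i : 'I_n, 'Z_2})%type.

Lemma unitsxC2_mulC (R : finComPzRingType) (n : nat) :
  commutative ( *%g : Monoid.law (1%g : unitsxC2 R n)).
Proof.
move=> [u f] [v g]; congr pair.
  by apply: val_inj; apply: mulrC.
by apply/ffunP=> i; rewrite !ffunE; apply: Zp_addC.
Qed.

HB.instance Definition _ (R : finComPzRingType) (n : nat) :=
  SemiGroup.isCommutativeLaw.Build (unitsxC2 R n) *%g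
    (@unitsxC2_mulC R n).

(* The library only provides the ring of functions for a constant family. An
   empty I yields the zero ring. *)
Section ProductRing.
Variables (I : finType) (L : I -> finComPzRingType).
Notation P := {dffun forall i, L i}.
Implicit Types x y z : P.

Definition dffun_zero : P := [ffun i => 0].
Definition dffun_one : P := [ffun i => 1].
Definition dffun_opp x : P := [ffun i => - x i].
Definition dffun_add x y : P := [ffun i => x i + y i].
Definition dffun_mul x y : P := [ffun i => x i * y i].

Lemma dffun_addA : associative dffun_add.
Proof. by move=> x y z; apply/ffunP=> i; rewrite !ffunE addrA. Qed.
Lemma dffun_addC : commutative dffun_add.
Proof. by move=> x y; apply/ffunP=> i; rewrite !ffunE addrC. Qed.
Lemma dffun_add0 : left_id dffun_zero dffun_add.
Proof. by move=> x; apply/ffunP=> i; rewrite !ffunE add0r. Qed.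
Lemma dffun_addN : left_inverse dffun_zero dffun_opp dffun_add.
Proof. by move=> x; apply/ffunP=> i; rewrite !ffunE addNr. Qed.
Lemma dffun_mulA : associative dffun_mul.
Proof. by move=> x y z; apply/ffunP=> i; rewrite !ffunE mulrA. Qed.
Lemma dffun_mulC : commutative dffun_mul.
Proof. by move=> x y; apply/ffunP=> i; rewrite !ffunE mulrC. Qed.
Lemma dffun_mul1 : left_id dffun_one dffun_mul.
Proof. by move=> x; apply/ffunP=> i; rewrite !ffunE mul1r. Qed.
Lemma dffun_mulD : left_distributive dffun_mul dffun_add.
Proof. by move=> x y z; apply/ffunP=> i; rewrite !ffunE mulrDl. Qed.

HB.instance Definition _ := GRing.isZmodule.Build P
  dffun_addA dffun_addC dffun_add0 dffun_addN.
HB.instance Definition _ := GRing.Zmodule_isComPzRing.Build P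
  dffun_mulA dffun_mulC dffun_mul1 dffun_mulD.

End ProductRing.

Definition ring_isomorphic (R S : pzRingType) : Prop :=
  exists f : {rmorphism R -> S}, bijective f.

(* idealr_closed includes 1 \notin M, so these ideals are proper. *)
Definition maximal_ideal (R : finComNzRingType) (M : {set R}) : Prop :=
  idealr_closed M /\
  forall J : {set R}, idealr_closed J -> M \subset J -> J = M.

Definition local_ring (R : finComNzRingType) : Prop :=
  exists! M : {set R}, maximal_ideal M.

(* mk_monic 'X^2 = 'X^2, as 'X^2 is monic of size 3, so this is F_2[x]/(x^2)
   with no change of modulus. *)
Definition F2_dual : comNzRingType := {poly %/ ('X^2 : {poly 'F_2})}.

(* Main.v *)
Require Import Defs.
From HB Require Import structures.
From mathcomp Require Import all_boot all_order all_algebra all_fingroup.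
From mathcomp Require Import all_solvable qpoly qfpoly ring zify.

Set Implicit Arguments.
Unset Strict Implicit.
Unset Printing Implicit Defensive.

Import GRing.Theory.
Local Open Scope ring_scope.

(** In a commutative group a sequence is irreducible exactly when it is
    zero-sum free, that is, when no nonempty subsequence has product $1$; and
    $D(S) - 1$ is the largest length of an irreducible sequence. So the theorem
    compares the irreducible sequences of $R$ with zero-sum free sequences of
    units.

    Write $R = \prod_j K_j$ with $K_j$ local, and let $A$ be irreducible with
    product $p$. In each component choose a set $T_j$ of terms that are
    nonunits there: all of them if $p_j \ne 0$, a minimal subset with product
    $0$ if $p_j = 0$. A subset of the terms outside all $T_j$ can be deleted
    without changing the product as soon as, in every component with $p_j \ne
    0$, its product stabilizes $p_j$. Hence these terms, replaced by $1$ where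
    $p_j = 0$, remain zero-sum free together with, for each $j$, any $|T_j|$
    units of $K_j$ that stabilize $p_j$ and are zero-sum free. Such units
    exist: along $1, x_1, x_1 x_2, \dots$, with $x_i$ nonunits and all products
    nonzero, the stabilizers form a strictly increasing chain of unit groups,
    and one element from each step gives a zero-sum free sequence
    ([fixing_zsf_steps]). This suffices if $p_j \ne 0$. If $p_j = 0$ it is one
    unit short, since the last factor brings the product to $0$, where the
    argument gives no new unit.

    In that case, if $K_j$ has no zero-sum free sequence of $|T_j|$ units at
    all, then no step of a chain given by $|T_j| - 1$ nonunits with nonzero
    product can have index larger than $2$, which forces the maximal ideal to
    be principal, the residue field to be $\mathbb F_2$ and $(1+x)^2 = 1$ for
    every generator $x$ of the maximal ideal; so $K_j$ is one of $\mathbb Z/2$,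
    $\mathbb Z/4$, $\mathbb Z/8$, $\mathbb F_2[x]/(x^2)$ ([tight_nil],
    [tight_cons]). These rings have unit group $C_2^r$ and nilpotency index $r
    + 1$ with $r = 0, 1, 2, 1$. For them the terms in $T_j$, at most $r + 1$ in
    number, are counted apart and the factor $C_2^r$ of the unit group is given
    up. With $X$ the set of components treated in this way, this yields
    [irreducible_to_units] and $D(R) \le D(U(R') \times C_2^{\sum_{j \notin X}
    r_j}) + \sum_{j \in X} (r_j + 1)$.

    Conversely, given $X$, a zero-sum free sequence of units which are $1$ on
    $X$ stays irreducible when for each $j \in X$ one adds $r_j + 1$ copies of
    a generator of the maximal ideal of $K_j$, all of which are needed to make
    the component $0$ ([irreducible_from_units]). The right-hand side above
    depends on $X$ only through the numbers of components of each kind, and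
    components $\mathbb Z/2$ may always be taken into $X$, which gives the
    two-parameter maximum. *)

(** * Zero-sum free sequences and the Davenport constant *)

Section ZeroSumFree.
Variables (S : finType) (e : S) (op : Monoid.com_law e).
Implicit Types s t : seq S.

Definition zero_sum_free s :=
  forall t, subseq t s -> seq_prod op t = e -> t = [::].

Lemma seq_prod_nil : seq_prod op [::] = e.
Proof. by rewrite /seq_prod big_nil. Qed.

Lemma seq_prod_cons x s : seq_prod op (x :: s) = op x (seq_prod op s).
Proof. by rewrite /seq_prod big_cons. Qed.

Lemma seq_prod_cat s t :
  seq_prod op (s ++ t) = op (seq_prod op s) (seq_prod op t).
Proof. by rewrite /seq_prod big_cat. Qed.

Lemma seq_prod_perm s t : perm_eq s t -> seq_prod op s = seq_prod op t.
Proof. exact: perm_big. Qed.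

Lemma seq_prod_mask m s : size m = size s ->
  op (seq_prod op (mask m s)) (seq_prod op (mask (map negb m) s))
    = seq_prod op s.
Proof.
elim: s m => [|x s IH] [|b m] //=; first by rewrite seq_prod_nil Monoid.mulm1.
case=> /IH; case: b => /=; rewrite !seq_prod_cons => <-.
  by rewrite Monoid.mulmA.
by rewrite Monoid.mulmCA.
Qed.

Lemma zero_sum_free_nil : zero_sum_free [::].
Proof. by move=> t; rewrite subseq0 => /eqP. Qed.

Lemma subseq_consP h s t :
  subseq t (h :: s) -> subseq t s \/ (exists2 u, subseq u s & t = h :: u).
Proof.
case: t => [|y t] /=; first by left; apply: sub0seq.
by case: eqP => [-> ts|_]; [right; exists t | left].
Qed.

Lemma zero_sum_free_cons h s :
  zero_sum_free s ->
  (forall t, subseq t s -> op h (seq_prod op t) <> e) ->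
  zero_sum_free (h :: s).
Proof.
move=> zs hs t /subseq_consP[/zs //|[u us ->]].
by rewrite seq_prod_cons => /(hs u us).
Qed.

Lemma zero_sum_free_perm s t :
  perm_eq s t -> zero_sum_free s -> zero_sum_free t.
Proof.
move=> pst zs u ut u1; have /count_subseqP[v vs puv] :
    forall x, (count_mem x u <= count_mem x s)%N.
  by move=> x; rewrite (seq.permP pst); apply: leq_count_subseq.
have := zs v vs; rewrite -(seq_prod_perm puv) u1 => /(_ erefl) v0.
by apply/nilP; rewrite /nilp (perm_size puv) v0.
Qed.

(** Replacing $g^2$ by two more copies of $g$ lengthens the sequence: the
    products of one, two or three copies of $g$ are $g$, $g^2$ and $g^2 g$,
    which are the products formed from the two terms $g$ and $g^2$. *)
Lemma zero_sum_free_square g s :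
  zero_sum_free [:: g, op g g & s] -> zero_sum_free [:: g, g, g & s].
Proof.
move=> zs; have zs' : zero_sum_free s.
  by move=> t ts; apply: zs; apply: subseq_trans ts (suffix_subseq [:: _; _] s).
have n1 t : subseq t s -> op g (seq_prod op t) <> e.
  move=> ts; rewrite -seq_prod_cons => /zs; rewrite /= eqxx.
  by move=> /(_ (subseq_trans ts (subseq_cons _ _))).
have n2 t : subseq t s -> op (op g g) (seq_prod op t) <> e.
  move=> ts t1; have: subseq (op g g :: t) [:: g, op g g & s].
    by apply: subseq_trans (subseq_cons _ _); rewrite /= eqxx.
  by move/zs; rewrite seq_prod_cons => /(_ t1).
have n3 t : subseq t s -> op g (op (op g g) (seq_prod op t)) <> e.
  move=> ts t1; have: subseq [:: g, op g g & t] [:: g, op g g & s].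
    by rewrite /= !eqxx.
  by move/zs; rewrite !seq_prod_cons => /(_ t1).
apply: zero_sum_free_cons => [|t].
  apply: zero_sum_free_cons => [|t]; first exact: zero_sum_free_cons zs' n1.
  by case/subseq_consP=> [/n1 //|[u us ->]];
    rewrite seq_prod_cons Monoid.mulmA; apply: n2.
case/subseq_consP=> [|[u + ->]]; case/subseq_consP=> [|[v vs ->]].
- exact: n1.
- by rewrite seq_prod_cons Monoid.mulmA; apply: n2.
- by move=> us; rewrite seq_prod_cons Monoid.mulmA; apply: n2.
- by rewrite !seq_prod_cons [X in op g X]Monoid.mulmA; apply: n3.
Qed.

Section Family.
Variables (I : finType) (a : I -> S).
Implicit Type B : {set I}.

Lemma big_filter_enum (B D : {set I}) : B \subset D ->
  \big[op/e]_(i <- [seq i <- enum D | i \in B]) a i = \big[op/e]_(i in B) a i.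
Proof.
move=> BD; rewrite big_filter big_enum_cond; apply: eq_bigl => i.
by apply: andb_idl => /(subsetP BD).
Qed.

Lemma zero_sum_free_familyP (D : {set I}) :
  zero_sum_free [seq a i | i <- enum D] <->
  (forall B, B \subset D -> \big[op/e]_(i in B) a i = e -> B = set0).
Proof.
split=> [zD B BD B1|zD t /subseqP[m]]; last first.
  rewrite size_map => sm ->; rewrite -map_mask /seq_prod big_map => t1.
  set u := mask m (enum D) in t1 *.
  have uD : [set i in u] \subset D.
    by apply/subsetP=> i; rewrite inE => /mem_mask; rewrite mem_enum.
  have uu : uniq u by rewrite mask_uniq ?enum_uniq.
  have /(zD _ uD) u0 : \big[op/e]_(i in [set i in u]) a i = e.
    by rewrite -[RHS]t1 big_uniq //; apply: eq_bigl => i; rewrite inE.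
  suff -> : u = [::] by [].
  by apply: size0nil; rewrite -(card_uniqP uu) -cardsE u0 cards0.
have := zD [seq a i | i <- [seq i <- enum D | i \in B]].
rewrite /seq_prod big_map big_filter_enum //.
move/(_ (map_subseq _ (filter_subseq _ _)) B1)/(congr1 size).
rewrite size_map /= => /size0nil B0.
apply/setP=> i; rewrite inE; apply/negbTE/negP=> iB.
suff: i \in [::] by [].
by rewrite -B0 mem_filter iB mem_enum (subsetP BD).
Qed.

End Family.

(** For a subset of positions rather than a subsequence: repeated terms are then
    told apart, so that sets of deleted terms can be intersected and united. *)
Lemma irreducible_tnth A (B : {set 'I_(size A)}) :
  ~~ reducible op A ->
  \big[op/e]_(i in ~: B) tnth (in_tuple A) i = seq_prod op A -> B = set0.
Proof.
move=> irr BA; apply/eqP; apply: contraR irr => /set0Pn[i iB].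
apply/reducibleP; set T := in_tuple A.
have AE : A = [seq tnth T i | i <- enum 'I_(size A)].
  by rewrite -[LHS]/(tval T) -[in LHS]map_tnth_enum.
exists [seq tnth T i | i <- [seq i <- enum 'I_(size A) | i \notin B]]; split.
- by rewrite [X in subseq _ X]AE map_subseq ?filter_subseq.
- rewrite [X in (_ < size X)%N]AE 2!size_map size_filter.
  have <- := count_predC (mem B) (enum 'I_(size A)).
  rewrite addnC -[X in (X < _)%N]addn0 ltn_add2l -has_count.
  by apply/hasP; exists i; rewrite ?mem_enum.
rewrite /seq_prod big_map big_filter big_enum_cond -[RHS]BA.
by apply: eq_bigl => j; rewrite !inE.
Qed.

(** Cutting a sequence longer than the Davenport constant down to that length
    shows that it is reducible. *)
Lemma davenport_gt A : ~~ reducible op A -> (size A < davenport op)%N.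
Proof.
rewrite /davenport; case: ex_minnP => k /andP[_ /forallP red] _ irr.
rewrite ltnNge; apply: contraNN irr => kA.
have sk : size (take k A) == k by rewrite size_takel.
have /reducibleP[B [sB ltB eqB]] := red (Tuple sk).
apply/reducibleP; exists (B ++ drop k A); split.
- by rewrite -[X in subseq _ X](cat_take_drop k A) cat_subseq.
- by rewrite -[X in (_ < size X)%N](cat_take_drop k A) !size_cat ltn_add2r.
- by rewrite -[in RHS](cat_take_drop k A) !seq_prod_cat eqB.
Qed.

Lemma davenport_witness :
  exists A, ~~ reducible op A /\ (size A).+1 = davenport op.
Proof.
rewrite /davenport; case: ex_minnP => -[|[|k]] // bk kmin.
  exists [::]; split=> //; apply/negP=> /reducibleP[B []].
  by rewrite subseq0 => /eqP ->.
have: ~~ davenport_bound op k.+1 by apply/negP=> /kmin; rewrite ltnn.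
rewrite negb_and /= => /forallPn[A irr]; exists A; split=> //.
by rewrite size_tuple.
Qed.

End ZeroSumFree.

(** In a group the terms whose deletion keeps the product have product $1$. *)
Lemma zero_sum_free_irreducible (gT : finGroupType)
    (op : Monoid.com_law (1%g : gT)) (s : seq gT) :
  (forall x y, op x y = (x * y)%g) ->
  zero_sum_free op s -> ~~ reducible op s.
Proof.
move=> opE zs; apply/negP=> /reducibleP[_ [/subseqP[m sm ->] lt]].
rewrite -[RHS](seq_prod_mask op sm) opE -[LHS]mulg1 => /mulgI /esym.
move/(zs _ (mask_subseq _ _)) /(congr1 size).
rewrite size_mask ?size_map // count_map; move/eqP; rewrite eqn0Ngt -has_count.
move/hasPn=> m1; move: lt; rewrite size_mask // -sm ltnNge => /negP; apply.
rewrite leq_eqVlt eq_sym -all_count; apply/orP; left; apply/allP=> b /m1.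
by rewrite /= negbK.
Qed.

(** * Finite rings whose nonunits are nilpotent *)

Section Invertible.
Variable K : finComPzRingType.
Implicit Types a b u x y : K.

Lemma invertibleP x : reflect (exists y, y * x = 1) (invertible x).
Proof. by apply: (iffP existsP) => -[y yx]; exists y; apply/eqP. Qed.

Lemma invertible_mulI u a b : invertible u -> u * a = u * b -> a = b.
Proof.
case/invertibleP=> v vu /(congr1 ( *%R v)).
by rewrite !mulrA vu !mul1r.
Qed.

Lemma invertible_mull x y : invertible (x * y) -> invertible x.
Proof.
case/invertibleP=> z zxy; apply/invertibleP.
by exists (z * y); rewrite -mulrA (mulrC y).
Qed.

Lemma invertible_prod (I : Type) (r : seq I) (P : pred I) (F : I -> K) :
  (forall i, P i -> invertible (F i)) -> invertible (\prod_(i <- r | P i) F i).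
Proof.
move=> invF; elim/big_ind: _ => //; first exact: invertible1.
exact: invertibleM.
Qed.

Lemma invertible_add1_nilpotent a n : a ^+ n = 0 -> invertible (1 + a).
Proof.
move=> an; apply/invertibleP; exists (\sum_(i < n) (- a) ^+ i).
have := subrX1 (- a) n; rewrite exprNn an mulr0 sub0r mulrC.
by move=> /(congr1 -%R); rewrite opprK -mulrN opprB opprK => <-.
Qed.

End Invertible.

(** All that the argument uses of local rings: in a finite commutative ring it
    is equivalent to having at most one maximal ideal. *)
Definition nilpotent_nonunits (K : finComPzRingType) : Prop :=
  forall a : K, ~~ invertible a -> exists n, a ^+ n = 0.

Section LocalRing.
Variable K : finComNzRingType.
Implicit Types (a b : K) (J : {set K}).

Definition is_ideal J : bool :=
  [&& 0 \in J, 1 \notin J &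
      [forall a, forall u in J, forall v in J, a * u + v \in J]].

Lemma is_idealP J : reflect (idealr_closed J) (is_ideal J).
Proof.
apply: (iffP and3P) => [] [J0 J1 Jlin]; split=> //.
  move=> a u v uJ vJ.
  by move/forallP/(_ a)/forall_inP/(_ u uJ)/forall_inP/(_ v vJ): Jlin.
apply/forallP=> a; apply/forall_inP=> u uJ; apply/forall_inP=> v vJ.
exact: Jlin.
Qed.

Lemma nonunit_in_maximal a :
  ~~ invertible a -> exists2 M, maximal_ideal M & a \in M.
Proof.
move=> na; pose J := [set b * a | b in K].
have idJ : is_ideal J.
  apply/is_idealP; split.
  - by apply/imsetP; exists 0; rewrite ?mul0r.
  - apply/negP=> /imsetP[b _ /esym ba]; move/negP: na; apply.
    by apply/invertibleP; exists b.
  - move=> c _ _ /imsetP[x _ ->] /imsetP[y _ ->]; apply/imsetP.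
    by exists (c * x + y) => //; rewrite mulrDl mulrA.
have [M /maxsetP[/is_idealP idM maxM] JM] := maxset_exists idJ.
exists M; last by apply: (subsetP JM); apply/imsetP; exists 1; rewrite ?mul1r.
by split=> // J' /is_idealP idJ' /maxM->.
Qed.

Lemma finite_power_eq a : exists i d, (0 < d)%N /\ a ^+ i * a ^+ d = a ^+ i.
Proof.
pose f (i : 'I_#|K|.+1) := a ^+ i.
have /injectivePn[i [j nij eqf]] : ~~ injectiveb f.
  by apply/injectiveP=> /leq_card; rewrite card_ord ltnn.
wlog lij : i j nij eqf / (i < j)%N => [W|].
  case: (ltngtP i j) => [||/val_inj eij]; first exact: W.
    by apply: W; rewrite 1?eq_sym.
  by rewrite eij eqxx in nij.
exists i, (j - i)%N; rewrite subn_gt0 lij -exprD subnKC ?(ltnW lij) //.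
Qed.

(** If $a^{i+d} = a^i$ with $a$ in the maximal ideal, then $1 - a^d$ lies
    outside it, so is a unit annihilating $a^i$. *)
Lemma local_nilpotent_nonunits : local_ring K -> nilpotent_nonunits K.
Proof.
case=> M [[idM _] uniqM] a na.
have inM b : ~~ invertible b -> b \in M.
  by case/nonunit_in_maximal=> M' /uniqM ->.
have [M0 M1 Mlin] := idM.
have [i [[|d] [// _ aid]]] := finite_power_eq a; exists i.
have u1 : invertible (1 - a ^+ d.+1).
  apply: contraTT M1 => /inM /(Mlin (a ^+ d) a _ (inM a na)).
  by rewrite -exprSr addrC subrK negbK.
apply: (invertible_mulI u1); rewrite mulr0 mulrBl mul1r mulrC aid subrr //. 

Qed.

End LocalRing.

(** * Sequences of units from sequences of nonunits *)

Section UnitSequences.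
Variable K : finComNzRingType.
Hypothesis nilK : nilpotent_nonunits K.
Implicit Types (a b u v x y : K) (s t xs : seq K).

Local Notation nonunit := (fun a : K => ~~ invertible a).
Local Notation zsf := (zero_sum_free (S := K) *%R).

Lemma add1_nonunit a : ~~ invertible a -> invertible (1 + a).
Proof. by case/nilK=> n; apply: invertible_add1_nilpotent. Qed.

Lemma nonunit_mull x y : ~~ invertible x -> ~~ invertible (x * y).
Proof. by apply: contraNN => /invertible_mull. Qed.

Definition fixing_zsf y s :=
  [/\ all (@invertible K) s, all (fun u => u * y == y) s & zsf s].

Definition has_unit_zsf n :=
  exists s, [/\ size s = n, all (@invertible K) s & zsf s].

(** Allows the classification below to argue by contradiction. *)
Lemma has_unit_zsf_dec n : has_unit_zsf n \/ ~ has_unit_zsf n.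
Proof.
pose good (s : seq K) := all (@invertible K) s &&
  [forall m : (size s).-tuple bool,
    (seq_prod (S := K) *%R (mask m s) == 1) ==> (mask m s == [::])].
have goodP s : good s <-> all (@invertible K) s /\ zsf s.
  split=> [/andP[-> /forallP zs]|[invs zs]].
    split=> // _ /subseqP[m /eqP sm ->] m1; apply/eqP.
    by have := zs (Tuple sm); rewrite m1 eqxx.
  rewrite /good invs; apply/forallP=> m; apply/implyP=> /eqP m1.
  by apply/eqP/zs; rewrite ?mask_subseq.
case: (boolP [exists s : n.-tuple K, good s]) => [|no].
  by case/existsP=> s /goodP[invs zs]; left; exists s; rewrite size_tuple.
right=> -[s [/eqP ss invs zs]]; case/negP: no; apply/existsP; exists (Tuple ss).
by apply/goodP.
Qed.

(** The translation $a \mapsto 1 + a$ exchanges nonunits and units when the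
    residue field has two elements. *)
Lemma card_units_nonunits :
  (forall a, invertible a -> ~~ invertible (a - 1)) ->
  #|[set a : K | invertible a]| = #|[set a : K | ~~ invertible a]|.
Proof.
move=> res; rewrite -[RHS](card_imset _ (addrI 1)); apply: eq_card => c.
rewrite [LHS]inE; apply/idP/imsetP=> [invc|[d + ->]].
  by exists (c - 1); rewrite ?inE ?res // addrC subrK.
by rewrite inE => /add1_nonunit.
Qed.

Lemma card_nonunits_double :
  (forall a, invertible a -> ~~ invertible (a - 1)) ->
  #|K| = (#|[set a : K | ~~ invertible a]| * 2)%N.
Proof.
move=> /card_units_nonunits card_eq; set M := [set a | ~~ _].
rewrite -(cardsC M) muln2 -addnn -[in RHS]card_eq; congr (_ + _)%N.
  by rewrite card_eq.
by apply: eq_card => a; rewrite !inE negbK.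
Qed.

Definition generates_nonunits x :=
  ~~ invertible x /\ forall a, ~~ invertible a -> exists b, a = x * b.

Lemma prod_generator x xs : generates_nonunits x -> all nonunit xs ->
  exists b, \prod_(y <- xs) y = x ^+ size xs * b.
Proof.
case=> _ genx; elim: xs => [|y xs IH] /=.
  by exists 1; rewrite big_nil mulr1.
case/andP=> /genx[c ->] /IH[b eqb]; exists (c * b).
by rewrite big_cons eqb exprS; ring.
Qed.

Lemma seq_prod_fix y s :
  all (fun u => u * y == y) s -> seq_prod (S := K) *%R s * y = y.
Proof.
elim: s => [_|u s IH /= /andP[/eqP uy /IH sy]].
  by rewrite seq_prod_nil mul1r.
by rewrite seq_prod_cons -mulrA sy.
Qed.

Lemma fixing_zsf_nil y : fixing_zsf y [::].
Proof. by split=> //; apply: zero_sum_free_nil. Qed.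

(** The products of subsequences of $s$ fix $y$, so none is inverse to a term
    that moves $y$. *)
Lemma fixing_zsf_cons y s u :
  fixing_zsf y s -> invertible u -> u * y != y ->
  all (@invertible K) (u :: s) /\ zsf (u :: s).
Proof.
case=> invs fixs zs invu /eqP uy; rewrite /= invu; split=> //.
apply: zero_sum_free_cons => // t ts ut; apply: uy.
have /seq_prod_fix ty : all (fun v => v * y == y) t.
  by apply/allP=> v /(mem_subseq ts); apply: (allP fixs).
by rewrite -[in u * y]ty mulrA ut mul1r.
Qed.

Lemma last_power x y : ~~ invertible x -> y != 0 ->
  exists e, y * x ^+ e != 0 /\ y * x ^+ e.+1 = 0.
Proof.
move=> /nilK[n xn] y0.
have ex : exists m, y * x ^+ m == 0 by exists n; rewrite xn mulr0.
case: (ex_minnP ex) => -[|m]; first by rewrite mulr1 (negbTE y0).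
move=> /eqP m0 mmin; exists m; split=> //.
by apply/negP=> /mmin; rewrite ltnn.
Qed.

(** If $x$ is a nonunit and $yx \ne 0$, the last power $x^{e+1}$ with
    $y x^{e+1} \ne 0$ gives a unit $1 + x^{e+1}$ which moves $y$ and fixes
    $yx$: the stabilizer grows strictly along $y, yx$. *)
Lemma fixing_zsf_step y s x :
  fixing_zsf y s -> ~~ invertible x -> y * x != 0 ->
  exists u, fixing_zsf (y * x) (u :: s).
Proof.
move=> fs nx yx0; have [e [e0 e1]] := last_power nx yx0.
pose u := 1 + x ^+ e.+1.
have invu : invertible u by apply: add1_nonunit; rewrite exprS nonunit_mull.
have uy : u * y != y.
  apply: contraNneq e0; rewrite mulrDl mul1r -[RHS]addr0 => /addrI yx.
  by rewrite -mulrA -exprS mulrC yx.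
have [invus zus] := fixing_zsf_cons fs invu uy; case: fs => _ fixs _.
exists u; split=> //=; apply/andP; split; last first.
  by apply: sub_all fixs => v /eqP vy; rewrite mulrA vy.
by rewrite mulrDl mul1r (mulrC (x ^+ _)) e1 addr0.
Qed.

Lemma fixing_zsf_steps y s xs :
  fixing_zsf y s -> all nonunit xs -> y * \prod_(x <- xs) x != 0 ->
  exists2 t, fixing_zsf (y * \prod_(x <- xs) x) (t ++ s) & size t = size xs.
Proof.
elim: xs y s => [|x xs IH] y s fs /=.
  by move=> _ _; exists [::]; rewrite // big_nil mulr1.
case/andP=> nx nxs; rewrite big_cons mulrA => yx0.
have yx : y * x != 0 by apply: contraNneq yx0 => ->; rewrite mul0r.
have [u fu] := fixing_zsf_step fs nx yx.
have [t ft st] := IH _ _ fu nxs yx0.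
by exists (rcons t u); rewrite ?cat_rcons // size_rcons st.
Qed.

Lemma zsf_pair u v : u != 1 -> v != 1 -> u * v != 1 -> zsf [:: u; v].
Proof.
move=> /eqP u1 /eqP v1 /eqP uv1; apply: zero_sum_free_cons.
  apply: zero_sum_free_cons; first exact: zero_sum_free_nil.
  by move=> t; rewrite subseq0 => /eqP ->; rewrite seq_prod_nil /= mulr1.
move=> t /subseq_consP[|[w + ->]]; rewrite subseq0 => /eqP ->.
  by rewrite seq_prod_nil /= mulr1.
by rewrite seq_prod_cons seq_prod_nil /= mulr1.
Qed.

(** The stabilizer chain of $x_1, \dots, x_n$ yields $n$ zero-sum free units.
    Here no choice of units does better, which makes every step of every such
    chain as small as possible; the lemmas below draw the consequences. *)
Definition tight xs :=
  [/\ all nonunit xs, \prod_(x <- xs) x != 0 & ~ has_unit_zsf (size xs).+1].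

(** A unit moving the full product could be added after the last step. *)
Lemma tight_fix xs u :
  tight xs -> invertible u -> u * \prod_(x <- xs) x = \prod_(x <- xs) x.
Proof.
case=> nxs p0 nolong invu; apply/eqP/negPn/negP=> uy; apply: nolong.
have [|t ft st] := fixing_zsf_steps (fixing_zsf_nil 1) nxs.
  by rewrite mul1r.
rewrite mul1r cats0 in ft; have [invs zs] := fixing_zsf_cons ft invu uy.
by exists (u :: t); rewrite /= st.
Qed.

Lemma tight_kill xs a :
  tight xs -> ~~ invertible a -> a * \prod_(x <- xs) x = 0.
Proof.
move=> txs na; have := tight_fix txs (add1_nonunit na).
by rewrite mulrDl mul1r -[RHS]addr0 => /addrI.
Qed.

(** Otherwise the unit $a - 1$ would annihilate the product fixed by $a$.  So the
    residue field has two elements. *)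
Lemma tight_residue xs a :
  tight xs -> invertible a -> ~~ invertible (a - 1).
Proof.
move=> txs inva; have p0 : \prod_(x <- xs) x != 0 by case: txs.
apply: contraNN p0 => inva1; apply/eqP; apply: (invertible_mulI inva1).
by rewrite mulr0 mulrBl mul1r tight_fix // subrr.
Qed.

(** Two units fixing $x$ that form a zero-sum free pair could replace the single
    unit of the first step of the chain. *)
Lemma tight_annihilator x xs a b : tight (x :: xs) ->
  a != 0 -> b != 0 -> a * x = 0 -> b * x = 0 -> (1 + a) * (1 + b) = 1.
Proof.
case=> /= /andP[nx nxs]; rewrite big_cons => p0 nolong a0 b0 ax bx.
have x0 : x != 0 by apply: contraNneq p0 => ->; rewrite mul0r.
have nonu c : c * x = 0 -> ~~ invertible c.
  move=> cx; apply: contraNN x0 => invc; apply/eqP.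
  by apply: (invertible_mulI invc); rewrite cx mulr0.
apply/eqP/negPn/negP=> ab; apply: nolong.
have fab : fixing_zsf x [:: 1 + a; 1 + b].
  split; first by rewrite /= !add1_nonunit ?nonu.
    by rewrite /= !mulrDl !mul1r ax bx addr0 eqxx.
  by apply: zsf_pair; rewrite // -subr_eq0 addrC addKr.
have [t [invt _ zt] st] := fixing_zsf_steps fab nxs p0.
by exists (t ++ [:: 1 + a; 1 + b]); rewrite size_cat st addn2.
Qed.

(** By [tight_annihilator] multiplication by $x$ has fibres of size at most
    $2$, so $|xK| \ge |K|/2$, which is the number of nonunits since the residue
    field has two elements. *)
Lemma tight_generator x xs a :
  tight (x :: xs) -> ~~ invertible a -> exists b, a = x * b.
Proof.
move=> txs na; have nx : ~~ invertible x by case: txs => /andP[].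
pose M := [set c : K | ~~ invertible c]; pose X := [set x * c | c : K].
have ann2 c d : c != 0 -> d != 0 -> c * x = 0 -> d * x = 0 -> c = d.
  move=> c0 d0 cx dx; have invc : invertible (1 + c).
    by apply/invertibleP; exists (1 + c); apply: (tight_annihilator txs).
  apply/(addrI 1)/(invertible_mulI invc).
  by rewrite !(tight_annihilator txs).
have XM : X \subset M.
  by apply/subsetP=> _ /imsetP[c _ ->]; rewrite inE nonunit_mull.
(* An element is determined by its multiple by $x$ and by whether it is the
   chosen representative of the fibre. *)
pose rep z := odflt 0 [pick c : K | x * c == z].
pose f c := (x * c, c == rep (x * c)).
have repP c : x * rep (x * c) = x * c.
  by rewrite /rep; case: pickP => [d /eqP //|/(_ c)]; rewrite eqxx.
have injf : injective f.
  move=> c d [eqx]; rewrite eqx; case: eqP => [-> /esym/eqP //|/eqP nc].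
  move=> /esym/negbT nd; have /addIr // : c - rep (x * d) = d - rep (x * d).
  by apply: ann2; rewrite ?subr_eq0 // mulrC mulrBr repP ?eqx subrr.
have: (#|K| <= #|X| * 2)%N.
  rewrite -card_bool -[#|{: bool}|]cardsT -cardsX.
  rewrite -[X in (X <= _)%N]cardsT -(card_imset setT injf).
  apply/subset_leq_card/subsetP=> _ /imsetP[c _ ->].
  by rewrite !inE andbT; apply: imset_f.
rewrite (card_nonunits_double (fun c => tight_residue txs)) leq_pmul2r // => MX.
have /eqP eqXM : X == M by rewrite eqEcard XM.
have : a \in M by rewrite inE.
by rewrite -eqXM => /imsetP[b _ ->]; exists b.
Qed.

Lemma prod_nseq n x : \prod_(y <- nseq n x) y = x ^+ n.
Proof. by elim: n => [|n IH]; rewrite ?big_nil //= big_cons IH exprS. Qed.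

Lemma tight_nseq x xs :
  generates_nonunits x -> tight xs -> tight (nseq (size xs) x).
Proof.
move=> genx [nxs p0 nolong]; split; rewrite ?size_nseq //.
  by rewrite all_nseq genx.1 orbT.
rewrite prod_nseq; apply: contraNneq p0 => xn.
by have [b ->] := prod_generator genx nxs; rewrite xn mul0r.
Qed.

Lemma generator_factor x c k b : generates_nonunits x -> c != 0 ->
  c = x ^+ k * b -> exists l v, [/\ (k <= l)%N, invertible v & c = x ^+ l * v].
Proof.
case=> nx genx c0; have [m xm] := nilK nx.
have: x ^+ (k + m) = 0 by rewrite exprD xm mulr0.
elim: m k b {xm} => [|m IH] k b xkm ceq.
  by move: c0; rewrite ceq -[k]addn0 xkm mul0r eqxx.
case: (boolP (invertible b)) => [invb|/genx[b' eqb]]; first by exists k, b.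
have [|| l [v [kl invv eqc]]] := IH k.+1 b'; first by rewrite addSnnS.
  by rewrite ceq eqb exprSr mulrA.
by exists l, v; rewrite (ltnW kl).
Qed.

(** If $(1+x)^2 = 1 + c$ with $c \ne 0$ of valuation $k$, the unit $1 + c$ may
    be used at the step of the chain $1, x, \dots, x^n$ where $1 + x^k$ would
    otherwise enter, and $1 + x$ at the last step.  Replacing $1 + c$ by two
    more copies of $1 + x$ then makes the sequence too long. *)
Lemma tight_generator_square x n :
  generates_nonunits x -> (0 < n)%N -> tight (nseq n x) ->
  (1 + x) * (1 + x) = 1.
Proof.
move=> genx n_gt0 tx; have [nx xK] := genx.
case: (tx) => _; rewrite prod_nseq size_nseq => xn nolong.
have xn1 : x ^+ n.+1 = 0 by have := tight_kill tx nx; rewrite prod_nseq exprS.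
pose c := (1 + x) * (1 + x) - 1.
have cE : (1 + x) * (1 + x) = 1 + c by rewrite [RHS]addrC subrK.
case: (eqVneq c 0) => [c0|c0]; first by rewrite cE c0 addr0.
case: nolong; have [b eq2] : exists b, 2%:R = x * b.
  apply: xK; apply: contraTN (invertible1 K) => /(tight_residue tx).
  by rewrite -[1 in X in ~~ invertible (X - _)]/1 (_ : 2%:R - 1 = 1) //; ring.
(* Since $2 \in xK$, the element $c = x^2 + 2x$ lies in $x^2K$; so $1 + c$
   enters strictly before the last step, at which $1 + x$ is needed. *)
have [|k [v [k_gt1 invv eqc]]] :=
  generator_factor (k := 2) (b := 1 + b) genx c0.
  have -> : c = x * x + 2%:R * x by rewrite /c; ring.
  by rewrite eq2; ring.
have kn : (k <= n)%N.
  rewrite leqNgt; apply: contraNN c0 => nk.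
  by rewrite eqc -(subnK nk) exprD xn1 mulr0 mul0r.
have nz m : (m <= n)%N -> x ^+ m != 0.
  by move=> mn; apply: contraNneq xn => xm; rewrite -(subnK mn) exprD xm mulr0.
have nns m : all nonunit (nseq m x) by rewrite all_nseq nx orbT.
set j := (n - k)%N.
have [|t1] := fixing_zsf_steps (fixing_zsf_nil 1) (nns j).
  by rewrite mul1r prod_nseq nz // leq_subr.
rewrite mul1r prod_nseq cats0 size_nseq => f1 s1.
have inv1 : invertible (1 + x) by apply: add1_nonunit.
have invc : invertible (1 + c) by rewrite -cE invertibleM.
have [|all1 z1] := fixing_zsf_cons f1 invc.
  rewrite mulrDl mul1r -[X in _ != X]addr0 (inj_eq (addrI _)) eqc.
  rewrite mulrAC -exprD subnKC //; apply: contraNneq xn => /eqP.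
  by move/eqP=> xv; apply/eqP/(invertible_mulI invv); rewrite mulr0 mulrC.
have f2 : fixing_zsf (x ^+ j.+1) (1 + c :: t1).
  split=> //=; apply/andP; split.
    rewrite mulrDl mul1r eqc mulrAC -exprD addnS subnKC // xn1 mul0r addr0.
    exact: eqxx.
  case: f1 => _ fix1 _; apply: sub_all fix1 => w /eqP wx.
  by rewrite exprSr mulrA wx.
have ejk : (j.+1 + (k - 2) = n.-1)%N.
  by rewrite /j; lia.
have [|t2] := fixing_zsf_steps f2 (nns (k - 2)%N).
  by rewrite prod_nseq -exprD ejk nz // leq_pred.
rewrite prod_nseq -exprD ejk size_nseq => f3 s2.
have [|all3 z3] := fixing_zsf_cons f3 inv1.
  rewrite mulrDl mul1r -[X in _ != X]addr0 (inj_eq (addrI _)).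
  by rewrite -exprS prednK.
exists [:: 1 + x, 1 + x, 1 + x & t2 ++ t1]; split.
- rewrite /= size_cat s1 s2; congr _.+1; rewrite -[RHS](prednK n_gt0) -ejk.
  by rewrite addSn addnC.
- move: all3; rewrite /= !all_cat /= => /and4P[-> -> _ ->]; by [].
apply: zero_sum_free_square; rewrite /= cE; apply: zero_sum_free_perm z3.
by rewrite perm_cons -cat1s perm_catCA.
Qed.

End UnitSequences.

(** * Local rings with too few units *)

Section RingIsomorphism.
Variables (R S : pzRingType).

Lemma ring_isomorphic_of (f : R -> S) :
  zmod_morphism f -> monoid_morphism f -> bijective f -> ring_isomorphic R S.
Proof.
move=> fB fM bij; pose F : {rmorphism R -> S} := HB.pack f
  (GRing.isZmodMorphism.Build _ _ f fB) (GRing.isMonoidMorphism.Build _ _ f fM).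
by exists F.
Qed.

Lemma ring_isomorphic_of_inverse (g : S -> R) :
  zmod_morphism g -> monoid_morphism g -> bijective g -> ring_isomorphic R S.
Proof.
move=> gB [g1 gM] [f gK fK]; have injg := can_inj gK.
apply: (@ring_isomorphic_of f); last by exists g.
- by move=> x y; apply: injg; rewrite gB !fK.
- by split=> [|x y]; apply: injg; rewrite ?g1 ?gM !fK.
Qed.

End RingIsomorphism.

Lemma ring_isomorphic_Zn n (K : comNzRingType) : (1 < n)%N ->
  n%:R = 0 :> K -> (forall a : K, exists k : nat, a = k%:R) ->
  (forall k : nat, (k < n)%N -> k%:R = 0 :> K -> k = 0%N) ->
  ring_isomorphic K 'Z_n.
Proof.
move=> n_gt1 n0 gen inj0.
have modR k : (k %% n)%:R = k%:R :> K.
  by rewrite [in RHS](divn_eq k n) natrD natrM n0 mulr0 add0r.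
have En := Zp_cast n_gt1.
pose g (i : 'Z_n) : K := (nat_of_ord i)%:R.
have gnat k : g k%:R = k%:R by rewrite /g val_Zp_nat // modR.
have gD x y : g (x + y) = g x + g y.
  by rewrite -[x]natr_Zp -[y]natr_Zp -natrD !gnat natrD.
have gB : zmod_morphism g.
  by move=> x y; apply: (canRL (addrK _)); rewrite -gD subrK.
apply: (@ring_isomorphic_of_inverse _ _ g) => //.
  split; first by rewrite -[1]/(1%:R) gnat.
  by move=> x y; rewrite -[x]natr_Zp -[y]natr_Zp -natrM !gnat natrM.
have injg : injective g.
  move=> x y /eqP; rewrite -subr_eq0 -gB => /eqP/inj0 xy0.
  apply/subr0_eq/val_inj/xy0.
  by have := ltn_ord (x - y); rewrite [X in (_ < X)%N]En.
have [h hP] : exists h : K -> 'Z_n, cancel h g.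
  have ex a : exists i : 'Z_n, g i == a.
    by have [k ->] := gen a; exists k%:R; rewrite gnat.
  by exists (fun a => xchoose (ex a)) => a; apply/eqP/(xchooseP (ex a)).
by exists h => // x; apply: injg; rewrite hP.
Qed.

(** This determines a ring of four elements, up to isomorphism
    $\mathbb F_2[x]/(x^2)$: the form in which both that ring and a tight ring of
    characteristic $2$ with $x^2 = 0$ are recognized. *)
Definition dual_numbers (K : comNzRingType) (x : K) :=
  [/\ 2%:R = 0 :> K, x * x = 0, x != 0
    & forall a, exists b c : bool, a = b%:R + c%:R * x].

Section DualNumbers.
Variables (K : comNzRingType) (x : K).
Hypothesis dK : dual_numbers x.

Lemma dual_numbers_inj (b c b' c' : bool) :
  b%:R + c%:R * x = b'%:R + c'%:R * x -> (b, c) = (b', c').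
Proof.
case: dK => _ xx /eqP x0 _ eq_bc.
have inj (d d' : bool) : d%:R * x = d'%:R * x -> d = d'.
  by case: d d' => [] [] //; rewrite mul1r mul0r => // /esym.
have eqb : b = b'.
  apply: inj; move/(congr1 ( *%R^~ x)): eq_bc.
  by rewrite /= !mulrDl -!mulrA xx !mulr0 !addr0.
by move: eq_bc; rewrite eqb => /addrI/inj ->.
Qed.

End DualNumbers.

Lemma dual_numbers_ops (K : comNzRingType) (x : K) (b c b' c' : bool) :
  dual_numbers x ->
  (b%:R + c%:R * x) - (b'%:R + c'%:R * x)
     = (b (+) b')%:R + (c (+) c')%:R * x /\
  (b%:R + c%:R * x) * (b'%:R + c'%:R * x)
     = (b && b')%:R + (b && c' (+) c && b')%:R * x.
Proof.
case=> n2 xx _ _; have boolD (d d' : bool) : (d (+) d')%:R = d%:R - d'%:R :> K.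
  case: d d' => [] []; rewrite ?subr0 ?subrr ?sub0r //.
  by apply/eqP; rewrite -addr_eq0 -[_ + _]/2%:R n2.
have boolDp (d d' : bool) : (d (+) d')%:R = d%:R + d'%:R :> K.
  by case: d d' => [] []; rewrite ?addr0 ?add0r // -[_ + _]/2%:R n2.
have boolM (d d' : bool) : (d && d')%:R = d%:R * d'%:R :> K.
  by case: d d' => [] []; rewrite ?mulr0 ?mul0r ?mulr1.
split; first by rewrite !boolD; ring.
rewrite boolDp !boolM -[RHS]addr0 -[X in _ = _ + X](mulr0 (c%:R * c'%:R)) -xx.
by ring.
Qed.

Lemma dual_numbers_isomorphic (K S : comNzRingType) (x : K) (y : S) :
  dual_numbers x -> dual_numbers y -> ring_isomorphic K S.
Proof.
move=> dK dS; case: (dK) => _ _ _ genK; case: (dS) => _ _ _ genS.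
have ex a : exists p : bool * bool, p.1%:R + p.2%:R * x == a.
  by have [b [c ->]] := genK a; exists (b, c).
pose f a := let p := xchoose (ex a) in p.1%:R + p.2%:R * y.
have fE (b c : bool) : f (b%:R + c%:R * x) = b%:R + c%:R * y.
  rewrite /f; case: (xchoose _) (xchooseP (ex (b%:R + c%:R * x))) => b' c' /=.
  by move/eqP/(dual_numbers_inj dK)=> [-> ->].
apply: (@ring_isomorphic_of _ _ f).
- move=> a a'; have [b [c ->]] := genK a; have [b' [c' ->]] := genK a'.
  rewrite (dual_numbers_ops _ _ _ _ dK).1 !fE.
  by rewrite (dual_numbers_ops _ _ _ _ dS).1.
- split=> [|a a']; first by have := fE true false; rewrite !mul0r !addr0.
  have [b [c ->]] := genK a; have [b' [c' ->]] := genK a'.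
  rewrite (dual_numbers_ops _ _ _ _ dK).2 !fE.
  by rewrite (dual_numbers_ops _ _ _ _ dS).2.
have exS s : exists p : bool * bool, p.1%:R + p.2%:R * y == s.
  by have [b [c ->]] := genS s; exists (b, c).
exists (fun s => let p := xchoose (exS s) in p.1%:R + p.2%:R * x).
  move=> a; have [b [c ->]] := genK a; rewrite fE.
  case: (xchoose _) (xchooseP (exS (b%:R + c%:R * y))) => b' c' /=.
  by move/eqP/(dual_numbers_inj dS)=> [-> ->].
by move=> s; rewrite fE; apply/eqP/(xchooseP (exS s)).
Qed.

Lemma F2_dual_dual_numbers : dual_numbers ('qX : F2_dual).
Proof.
have X2 : ('X^2 : {poly 'F_2}) \is monic by apply: monicXn.
have sX2 : (2 < size ('X^2 : {poly 'F_2}))%N by rewrite size_polyXn.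
have qXE := qpolyXE sX2 X2.
pose pi : {poly 'F_2} -> F2_dual := in_qpoly 'X^2.
have piD p q : pi (p + q) = pi p + pi q by apply: in_qpolyD.
have piM p q : pi (p * q) = pi p * pi q by apply: in_qpolyM.
have pi1 : pi 1 = 1 by apply: in_qpoly1.
have pi0 : pi 0 = 0 by apply: in_qpoly0.
have pib (b : bool) : pi b%:R = b%:R by case: b.
split.
- rewrite -[2%:R]/(1 + 1) -!pi1 -piD -[1 + 1]/(2%:R) -polyC_natr.
  by rewrite (_ : 2%:R = 0 :> 'F_2) ?polyC0 ?pi0 //; apply: val_inj.
- rewrite -piM -pi0; apply: val_inj => /=.
  rewrite mk_monic_Xn -expr2 Pdiv.RingMonic.rmodpp ?monicXn //.
  by rewrite Pdiv.Ring.rmod0p.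
- pose rem (q : {poly %/ ('X^2 : {poly 'F_2})}) : {poly 'F_2} := q.
  apply/negP=> /eqP/(congr1 rem).
  by rewrite /rem qXE => /eqP; rewrite polyX_eq0.
move=> a; pose p : {poly 'F_2} := (a : {poly %/ ('X^2 : {poly 'F_2})}).
have F2b (c : 'F_2) : exists b : bool, c = b%:R.
  by case: c => -[|[|//]] lt; [exists false | exists true]; apply: val_inj.
have [[b p0] [c p1]] := (F2b p`_0, F2b p`_1); exists b, c.
have pE : p = b%:R + c%:R * 'X.
  have sp : (size p <= 2)%N.
    have sm : size (mk_monic ('X^2 : {poly 'F_2})) = 3.
      by rewrite mk_monic_Xn size_polyXn.
    by rewrite -ltnS -[X in (_ < X)%N]sm; apply: size_mk_monic a.
  apply/polyP=> -[|[|i]]; rewrite -!polyC_natr coefD coefC coefMX coefC /=.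
  - by rewrite p0 addr0.
  - by rewrite p1 add0r.
  by rewrite addr0 nth_default // (leq_trans sp).
rewrite -!pib -piM -piD -pE; apply: val_inj; apply/esym/in_qpoly_small.
exact: size_mk_monic.
Qed.

Section TightClassification.
Variable K : finComNzRingType.
Hypothesis nilK : nilpotent_nonunits K.
Implicit Types (a x : K) (xs : seq K).

Lemma tight_nil : tight (K := K) [::] -> ring_isomorphic K 'Z_2.
Proof.
move=> t0; have nz a : ~~ invertible a -> a = 0.
  by move/(tight_kill nilK t0); rewrite big_nil mulr1.
have n2 : 2%:R = 0 :> K.
  apply: nz; apply: contraTN (invertible1 K) => /(tight_residue nilK t0).
  by rewrite (_ : 2%:R - 1 = 1) //; ring.
apply: ring_isomorphic_Zn => // [a|[|[|k]] // _ /eqP]; last first.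
  by rewrite oner_eq0.
case: (boolP (invertible a)) => [|/nz ->].
  by move=> /(tight_residue nilK t0)/nz/subr0_eq ->; exists 1.
by exists 0.
Qed.

(** The square of $1+x$ being $1$ means $x^2 = -2x$, for every generator $x$ of
    the maximal ideal.  If $x^2 \ne 0$ then $2$ is not of the form $x^2 c$, which
    would give $x^2(1 + xc) = 0$; so $2$ is itself a generator, and $4 = -4$. *)
Lemma tight_cons x xs : tight (x :: xs) ->
  [\/ ring_isomorphic K 'Z_4, ring_isomorphic K 'Z_8
    | ring_isomorphic K F2_dual].
Proof.
move=> txs; have genx : generates_nonunits x.
  split=> [|a]; last exact: (tight_generator nilK txs).
  by case: txs => /= /andP[].
have sq (z : K) : generates_nonunits z -> z * z = - (2%:R * z).
  move=> genz; have tz := tight_nseq genz txs.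
  have z1 := tight_generator_square nilK genz (ltn0Sn _) tz.
  apply/eqP; rewrite -addr_eq0; apply/eqP.
  have -> : z * z + 2%:R * z = (1 + z) * (1 + z) - 1 by ring.
  by rewrite z1 subrr.
have [nx xK] := genx; have res := tight_residue nilK txs.
have n2 : ~~ invertible (2%:R : K).
  apply: contraTN (invertible1 K) => /res.
  by rewrite (_ : 2%:R - 1 = 1) //; ring.
have x0 : x != 0.
  by case: txs => _ p0 _; apply: contraNneq p0 => ->; rewrite big_cons mul0r.
case: (eqVneq (x * x) 0) => [xx|xx].
  have zx a : ~~ invertible a -> a = 0 \/ a = x.
    case/xK=> b ->; case: (boolP (invertible b)) => [/res/xK[c]|/xK[c ->]].
      move=> eqb; right; rewrite -(subrK 1 b) eqb mulrDr mulrA xx mul0r.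
      by rewrite add0r mulr1.
    by left; rewrite mulrA xx mul0r.
  have elts a : exists b c : bool, a = b%:R + c%:R * x.
    case: (boolP (invertible a)) => [/res/zx[/subr0_eq ->|]|/zx[->|->]].
    - by exists true, false; rewrite mul0r addr0.
    - by move=> eqa; exists true, true; rewrite mul1r -eqa addrC subrK.
    - by exists false, false; rewrite mul0r addr0.
    - by exists false, true; rewrite mul1r add0r.
  case: (zx _ n2) => [n20|n2x].
    have dx : dual_numbers x by split.
    exact/Or33/(dual_numbers_isomorphic dx F2_dual_dual_numbers).
  apply: Or31; apply: ring_isomorphic_Zn => //.
  - by rewrite (natrM K 2 2) n2x.
  - move=> a; have [b [c ->]] := elts a.
    by exists (b + c * 2)%N; rewrite natrD natrM n2x.
  case=> [|[|[|[|k]]]] //= _.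
  - by move/eqP; rewrite oner_eq0.
  - by move/eqP; rewrite n2x (negbTE x0).
  rewrite (natrD K 1 2) n2x => x1; have := add1_nonunit nilK nx.
  by rewrite x1 => /invertibleP[y /eqP]; rewrite mulr0 eq_sym oner_eq0.
have [b eq2] := xK _ n2.
have invb : invertible b.
  apply: contraTT xx => /xK[c eqb]; rewrite negbK.
  have inv1 : invertible (1 + x * c) by apply: add1_nonunit (nonunit_mull _ nx).
  apply/eqP; apply: (invertible_mulI inv1); rewrite mulr0 mulrDl mul1r.
  by rewrite [X in X + _](sq x genx) eq2 eqb; ring.
have gen2 : generates_nonunits (2%:R : K).
  split=> // a /xK[c ->]; have /invertibleP[b' b'b] := invb.
  by exists (b' * c); rewrite eq2 -mulrA (mulrA b) (mulrC b) b'b mul1r.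
have n40 : 4%:R != 0 :> K.
  apply: contraNneq xx => n4; apply/eqP.
  apply: (invertible_mulI (invertibleM invb invb)).
  rewrite mulr0 -n4 (natrM K 2 2) eq2; ring.
have n8 : 8%:R = 0 :> K.
  have := sq _ gen2; rewrite -natrM => /eqP; rewrite -addr_eq0 -natrD.
  by move/eqP.
(* Three binary digits suffice for every element, because $8 = 0$. *)
apply: Or32; apply: ring_isomorphic_Zn => // [a|k lt8 k0].
  have step c : exists (d : K) (e : bool), c = e%:R + 2%:R * d.
    case: (boolP (invertible c)) => [/res|] /(gen2.2)[d eqc].
      by exists d, true; rewrite -eqc addrC subrK.
    by exists d, false; rewrite add0r.
  have [d [e ->]] := step a; have [d' [e' ->]] := step d.
  have [d'' [e'' ->]] := step d'; exists (e + 2 * e' + 4 * e'')%N.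
  rewrite natrD [(e + 2 * e')%:R]natrD !natrM -[RHS]addr0.
  by rewrite -[X in _ = _ + X](mul0r d'') -n8; ring.
(* Each nonzero $k < 8$ has a multiple congruent to $4$ modulo $8$. *)
apply/eqP; apply: contraNT n40 => k_gt0; apply/eqP.
suff [m [l eqm]] : exists m l : nat, (k * m = 4 + l * 8)%N.
  have := natrM K k m; rewrite k0 mul0r eqm natrD natrM n8 mulr0 addr0.
  by [].
case: k lt8 k_gt0 {k0} => [|[|[|[|[|[|[|[|k]]]]]]]] // _ _.
- by exists 4, 0.
- by exists 2, 0.
- by exists 4, 1.
- by exists 1, 0.
- by exists 4, 2.
- by exists 2, 1.
- by exists 4, 3.
Qed.

(** A minimal set of nonunits with product $0$ becomes, without one of them, a
    sequence to which this applies; so all of its members, the last one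
    included, can be traded for units. *)
Definition saturated := forall xs, all (fun x : K => ~~ invertible x) xs ->
  \prod_(x <- xs) x != 0 -> has_unit_zsf K (size xs).+1.

Lemma other_local_saturated :
  [/\ ~ ring_isomorphic K 'Z_2, ~ ring_isomorphic K 'Z_4,
      ~ ring_isomorphic K 'Z_8 & ~ ring_isomorphic K F2_dual] -> saturated.
Proof.
case=> n2 n4 n8 nd xs nxs p0.
case: (has_unit_zsf_dec K (size xs).+1) => // nolong.
case: xs nxs p0 nolong => [|x xs] nxs p0 nolong.
  by case: n2; apply: tight_nil.
have /tight_cons[] // : tight (x :: xs) by [].
Qed.

End TightClassification.

(** * The exceptional rings *)

(** The common shape of $\mathbb Z/2$ ($r = 0$, $z = 0$), $\mathbb Z/4$ and
    $\mathbb Z/8$ ($z = 2$, $r = 1, 2$) and $\mathbb F_2[x]/(x^2)$ ($z = x$,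
    $r = 1$): the maximal ideal $zK$ has nilpotency index $r + 1$ and the unit
    group $1 + zK$ is elementary abelian of rank $r$. *)
Definition exceptional_at (K : finComNzRingType) (r : nat) (z : K) :=
  [/\ z ^+ r != 0, z ^+ r.+1 = 0,
      forall a, exists b, a = z * b \/ a = 1 + z * b,
      forall b, (1 + z * b) * (1 + z * b) = 1
    & #|K| = (2 ^ r.+1)%N].

Definition exceptional (K : finComNzRingType) (r : nat) :=
  exists z : K, exceptional_at r z.

Section Exceptional.
Variables (K : finComNzRingType) (r : nat).
Implicit Types a z : K.

Lemma exceptional_nonunit z a :
  exceptional_at r z -> ~~ invertible a = (a \in [set z * b | b : K]).
Proof.
case=> _ zr gen sq _; apply/idP/imsetP=> [na|[b _ ->]].
  have [b [->|eqa]] := gen a; first by exists b.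
  by case/invertibleP: na; exists a; rewrite eqa.
apply: contraNN (oner_neq0 K) => invzb.
have invz : invertible z by apply: invertible_mull invzb.
have : invertible (z ^+ r.+1).
  by elim: r.+1 => [|m IH]; rewrite ?exprS ?invertibleM ?expr0 ?invertible1.
by rewrite zr => /invertibleP[y]; rewrite mulr0 => <-.
Qed.

Lemma exceptional_generator z : exceptional_at r z -> generates_nonunits z.
Proof.
move=> ez; split=> [|a]; rewrite (exceptional_nonunit _ ez).
  by apply/imsetP; exists 1; rewrite ?mulr1.
by case/imsetP=> b _ ->; exists b.
Qed.

Lemma exceptional_nilpotent : exceptional K r -> nilpotent_nonunits K.
Proof.
case=> z ez a; have [_ zK] := exceptional_generator ez.
by case: ez => _ zr _ _ _ /zK[b ->]; exists r.+1; rewrite exprMn zr mul0r.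
Qed.

Lemma exceptional_length (xs : seq K) : exceptional K r ->
  all (fun x : K => ~~ invertible x) xs -> \prod_(x <- xs) x != 0 ->
  (size xs <= r)%N.
Proof.
case=> z ez nxs; apply: contraNT; rewrite -ltnNge => lt.
have [b ->] := prod_generator (exceptional_generator ez) nxs.
case: ez => _ zr _ _ _.
by rewrite -(subnK lt) exprD zr mulr0 mul0r.
Qed.

Lemma exceptional_unit_square (u : K) :
  exceptional K r -> invertible u -> u * u = 1.
Proof.
case=> z ez; have := exceptional_nonunit u ez; case: ez => _ _ gen sq _.
have [b [->|-> //]] := gen u; rewrite imset_f // => /negP //.
Qed.

Lemma exceptional_card_units :
  exceptional K r -> #|[pred u : K | invertible u]| = (2 ^ r)%N.
Proof.
move=> ex; have nilK := exceptional_nilpotent ex; case: ex => z ez.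
have res a : invertible a -> ~~ invertible (a - 1).
  have nz b : ~~ invertible (z * b).
    by rewrite (exceptional_nonunit _ ez) imset_f.
  case: (ez) => _ _ /(_ a)[b [->|->]] _ _; first by rewrite (negbTE (nz b)).
  by move=> _; rewrite addrC addKr.
have := card_nonunits_double nilK res; case: ez => _ _ _ _ ->.
rewrite expnS mulnC => /eqP; rewrite eqn_pmul2r // -card_units_nonunits //.
by move/eqP->; apply: eq_card => a; rewrite !inE.
Qed.

End Exceptional.

Lemma natr_half n (a : 'Z_n) : a = (odd a)%:R + 2%:R * (a./2)%:R.
Proof. by rewrite -natrM -natrD mul2n odd_double_half natr_Zp. Qed.

Lemma exceptional_Z2 : exceptional 'Z_2 0.
Proof.
exists 0; split; rewrite ?expr0 ?expr1 ?card_ord ?oner_neq0 //.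
  move=> a; exists 0; rewrite mulr0 addr0.
  by case: a => -[|[|//]] lt; [left | right]; apply: val_inj.
by move=> b; rewrite mul0r addr0 mulr1.
Qed.

Lemma exceptional_Z4 : exceptional 'Z_4 1.
Proof.
exists 2%:R; split; rewrite ?card_ord //.
- by apply: val_inj.
- move=> a; exists (a./2)%:R; rewrite {1 3}[a]natr_half.
  by case: odd; [right | left; rewrite add0r].
by case=> -[|[|[|[|//]]]] lt; apply: val_inj.
Qed.

Lemma exceptional_Z8 : exceptional 'Z_8 2.
Proof.
exists 2%:R; split; rewrite ?card_ord //.
- by apply: val_inj.
- move=> a; exists (a./2)%:R; rewrite {1 3}[a]natr_half.
  by case: odd; [right | left; rewrite add0r].
by case=> -[|[|[|[|[|[|[|[|//]]]]]]]] lt; apply: val_inj.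
Qed.

Lemma exceptional_F2_dual : exceptional F2_dual 1.
Proof.
have [n2 xx x0 gen] := F2_dual_dual_numbers; exists 'qX.
split; rewrite ?expr1 ?expr2 //.
- move=> a; have [b [c ->]] := gen a; exists c%:R; rewrite [c%:R * _]mulrC.
  by case: b; [right | left; rewrite add0r].
- move=> b; have -> : (1 + 'qX * b) * (1 + 'qX * b)
      = 1 + 2%:R * ('qX * b) + 'qX * 'qX * (b * b) :> F2_dual by ring.
  by rewrite n2 xx !mul0r !addr0.
rewrite -[#|_|]/(#|{poly %/ ('X^2 : {poly 'F_2})}|).
by rewrite card_monic_qpoly ?size_polyXn ?monicXn // card_ord.
Qed.

(** * Products of rings *)

Section Component.
Variables (K : finComNzRingType) (I : finType) (a : I -> K).
Hypothesis nilK : nilpotent_nonunits K.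
Implicit Types (T B D : {set I}) (w h : I -> K).

Let p := \prod_i a i.

(** The terms at positions in [T] already account for the ideal generated by the
    product $p$; a set of other positions is deletable when the product of the
    units [w], which stand for the terms there, stabilizes $p$. *)
Definition separated T w :=
  forall B, B \subset ~: T -> \prod_(i in B) w i * p = p ->
    \prod_(i in ~: B) a i = p.

(** Units that take the places of the terms in [T]; as they fix $p$, they drop out
    when a product containing them is tested for stabilizing $p$. *)
Definition replaced T h :=
  [/\ forall i, i \in T -> invertible (h i),
      forall i, i \in T -> h i * p = p
    & forall B, B \subset T -> \prod_(i in B) h i = 1 -> B = set0].

Lemma prod_setC B (F : I -> K) :
  \prod_i F i = \prod_(i in B) F i * \prod_(i in ~: B) F i.
Proof.
rewrite (bigID (mem B)) /=; congr (_ * _).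
by apply: eq_bigl => i; rewrite inE.
Qed.

Lemma zsf_family T (s : seq K) :
  size s = #|T| -> zero_sum_free (S := K) *%R s ->
  exists h, (forall i, i \in T -> h i \in s) /\
    (forall B, B \subset T -> \prod_(i in B) h i = 1 -> B = set0).
Proof.
move=> sT zs; pose h i := nth 1 s (index i (enum T)).
have hE : [seq h i | i <- enum T] = s.
  apply: (@eq_from_nth _ 1); first by rewrite size_map -cardE.
  move=> k; rewrite size_map => lt; have [i0] : exists i0 : I, True.
    by case: (enum T) lt => // i0; exists i0.
  by move=> _; rewrite (nth_map i0) // /h index_uniq ?enum_uniq.
exists h; split=> [i iT|]; last first.
  by apply/(zero_sum_free_familyP *%R); rewrite hE.
by rewrite -hE map_f ?mem_enum.
Qed.

(** With $T$ the set of all nonunit terms, the product over $T$ is associated to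
    $p \ne 0$, so its stabilizer chain provides units fixing $p$. *)
Lemma component_nonzero : p != 0 ->
  exists T w h, [/\ separated T w, forall i, invertible (w i) & replaced T h].
Proof.
move=> p0; pose T := [set i | ~~ invertible (a i)].
have pE := prod_setC T a; pose xs := [seq a i | i <- enum T].
have xsE : \prod_(x <- xs) x = \prod_(i in T) a i.
  by rewrite /xs big_map big_enum.
have xs0 : \prod_(x <- xs) x != 0.
  by apply: contraNneq p0; rewrite xsE /p pE => ->; rewrite mul0r.
have nxs : all (fun x => ~~ invertible x) xs.
  by apply/allP=> _ /mapP[i + ->]; rewrite mem_enum inE.
have [|s] := fixing_zsf_steps nilK (fixing_zsf_nil 1) nxs.
  by rewrite mul1r.
rewrite cats0 mul1r size_map -cardE => -[invs fixs zs] ss.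
have [h [hs zh]] := zsf_family ss zs.
exists T, (fun i => if invertible (a i) then a i else 1), h; split.
- move=> B BT; rewrite (eq_bigr a) => [wp|i]; last first.
    by move/(subsetP BT); rewrite !inE negbK => ->.
  have invB : invertible (\prod_(i in B) a i).
    by apply: invertible_prod => i /(subsetP BT); rewrite !inE negbK.
  by apply: (invertible_mulI invB); rewrite wp -prod_setC.
- by move=> i; case: ifP => // _; apply: invertible1.
split=> // i /hs his; first exact: (allP invs).
by rewrite /p pE mulrA -xsE; move/allP/(_ _ his)/eqP: fixs ->.
Qed.

(** A minimal set of nonunit terms with product $0$; every set of other terms
    can then be deleted, whence the units $1$. *)
Lemma component_zero : p = 0 ->
  exists T, [/\ separated T (fun=> 1), {in T, forall i, ~~ invertible (a i)}
    & exists2 k, k \in T & \prod_(i in T :\ k) a i != 0].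
Proof.
move=> p0; pose N := [set i | ~~ invertible (a i)].
pose good (T : {set I}) := (T \subset N) && (\prod_(i in T) a i == 0).
have goodN : good N.
  have invN : invertible (\prod_(i in ~: N) a i).
    by apply: invertible_prod => i; rewrite !inE negbK.
  rewrite /good subxx; apply/eqP/(invertible_mulI invN).
  by rewrite mulr0 mulrC -prod_setC.
have [T /minsetP[/andP[TN /eqP T0] minT] _] := minset_exists goodN.
exists T; split.
- move=> B BT _; rewrite p0 (big_setID T) /=.
  by rewrite (setIidPr _) ?T0 ?mul0r // -(setCK T) setCS.
- by move=> i /(subsetP TN); rewrite inE.
have [Te|[k kT]] := set_0Vmem T.
  by move: T0; rewrite Te big_set0 => /eqP; rewrite oner_eq0.
exists k => //; apply: contraTneq kT => Tk0.
rewrite -(minT (T :\ k)) ?setD11 ?subD1set // /good Tk0 eqxx andbT.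
exact: subset_trans (subD1set _ _) TN.
Qed.

Lemma component_saturated : saturated K ->
  exists T w h, [/\ separated T w, forall i, invertible (w i) & replaced T h].
Proof.
move=> satK; case: (eqVneq p 0) => [p0|]; last exact: component_nonzero.
have [T [sepT nT [k kT Tk]]] := component_zero p0.
have [||s] := satK [seq a i | i <- enum (T :\ k)].
- apply/allP=> _ /mapP[i + ->]; rewrite mem_enum in_setD1 => /andP[_].
  exact: nT.
- by rewrite big_map big_enum.
rewrite size_map -cardE => -[ss invs zs].
have [|h [hs zh]] := zsf_family (T := T) _ zs.
  by rewrite ss (cardsD1 k T) kT.
exists T, (fun=> 1), h; split=> // [i|]; first exact: invertible1.
by split=> // i /hs his; [apply: (allP invs) | rewrite p0 mulr0].
Qed.

Lemma component_exceptional r : exceptional K r ->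
  exists T w h kill, [/\ separated T w, forall i, invertible (w i)
    & if kill then (forall i, w i = 1) /\ (#|T| <= r.+1)%N else replaced T h].
Proof.
move=> exK; case: (eqVneq p 0) => [p0|p0]; last first.
  by have [T [w [h [sep invw rep]]]] := component_nonzero p0;
    exists T, w, h, false.
have [T [sepT nT [k kT Tk]]] := component_zero p0.
exists T, (fun=> 1), (fun=> 1), true; split=> // [i|]; first exact: invertible1.
split=> //; pose xs := [seq a i | i <- enum (T :\ k)].
have := exceptional_length (xs := xs) exK.
rewrite size_map -cardE (cardsD1 k T) kT; apply; last first.
  by rewrite big_map big_enum.
apply/allP=> _ /mapP[i + ->]; rewrite mem_enum in_setD1 => /andP[_].
exact: nT.
Qed.

End Component.

Section ProductMonoid.
Variables (S : finType) (e : S) (op : Monoid.com_law e).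
Variables (J : finType) (K : J -> finComNzRingType).
Variables (phi : forall j, S -> K j) (psi : (forall j, K j) -> S).
Hypothesis phi1 : forall j, phi j e = 1.
Hypothesis phiM : forall j x y, phi j (op x y) = phi j x * phi j y.
Hypothesis phi_inj : forall x y, (forall j, phi j x = phi j y) -> x = y.
Hypothesis phiK : forall f j, phi j (psi f) = f j.
Variables (exc : {set J}) (r : J -> nat).
Hypothesis nilK : forall j, nilpotent_nonunits (K j).
Hypothesis excK : forall j, j \in exc -> exceptional (K j) (r j).
Hypothesis otherK : forall j, j \notin exc -> saturated (K j).

Definition units_off (X : {set J}) (x : S) : bool :=
  [forall j, invertible (phi j x) && ((j \in X) ==> (phi j x == 1))].

Lemma phi_big j (I : Type) (s : seq I) (P : pred I) (F : I -> S) :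
  phi j (\big[op/e]_(i <- s | P i) F i) = \prod_(i <- s | P i) phi j (F i).
Proof. by rewrite (big_morph (phi j) (phiM j) (phi1 j)). Qed.

Lemma component_choice (I : finType) (a : I -> S) j :
  exists T w h (kill : bool), [/\ separated (fun i => phi j (a i)) T w,
    forall i, invertible (w i), kill -> j \in exc
  & if kill then (forall i, w i = 1) /\ (#|T| <= (r j).+1)%N
    else replaced (fun i => phi j (a i)) T h].
Proof.
case: (boolP (j \in exc)) => [je|je].
  have [T [w [h [kill [sepT invw T2]]]]] :=
    component_exceptional (fun i => phi j (a i)) (nilK (j := j)) (excK je).
  by exists T, w, h, kill.
have [T [w [h [sepT invw T2]]]] :=
  component_saturated (fun i => phi j (a i)) (nilK (j := j)) (otherK je).
by exists T, w, h, false.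
Qed.

(** The new sequence keeps the positions of $A$: a position in no $T_j$ carries
    the units [w], one in some $T_j$ is given to a single such $j$ and carries
    the unit [h] in that component only; the positions given to components in
    $X$ are dropped. If some of these terms have product $1$, those in no $T_j$
    stabilize $p$ in every component, so they could be deleted from $A$ and
    there are none; the rest then splits by components. *)
Lemma irreducible_to_units A : ~~ reducible op A ->
  exists (X : {set J}) B, [/\ X \subset exc, all (units_off X) B,
    zero_sum_free op B & (size A <= size B + \sum_(j in X) (r j).+1)%N].
Proof.
move=> irr; pose a i := tnth (in_tuple A) i.
have [T /fin_all_exists[w /fin_all_exists[h /fin_all_exists[kill data]]]] :=
  fin_all_exists (component_choice a).
have sep j : separated (fun i => phi j (a i)) (T j) (w j) by case: (data j).
have invw j i : invertible (w j i) by case: (data j).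
have killP j : kill j ->
    [/\ j \in exc, forall i, w j i = 1 & (#|T j| <= (r j).+1)%N].
  by case: (data j) => _ _ + + kj; rewrite kj => -> // -[].
have keepP j : ~~ kill j -> replaced (fun i => phi j (a i)) (T j) (h j).
  by case: (data j) => _ _ _; case: (kill j).
pose X := [set j | kill j]; pose sg i := [pick j | i \in T j].
have sgT i j : sg i = Some j -> i \in T j.
  by rewrite /sg; case: pickP => // j' + [<-].
have sgN i j : sg i = None -> i \notin T j.
  by rewrite /sg; case: pickP => // no _; rewrite no.
pose b i := psi (fun j => if sg i == Some j then h j i
                          else if sg i == None then w j i else 1).
pose D := [set i | if sg i is Some j then ~~ kill j else true].
exists X, [seq b i | i <- enum D]; split.
- by apply/subsetP=> j; rewrite inE => /killP[].
- apply/allP=> _ /mapP[i + ->]; rewrite mem_enum inE => iD.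
  apply/forallP=> j; rewrite phiK inE.
  case: eqP iD => [eqj|_ _]; last first.
    apply/andP; split; first by case: ifP => // _; apply: invertible1.
    by apply/implyP=> /killP[_ -> _]; rewrite if_same.
  rewrite eqj => kj; rewrite (negbTE kj) andbT.
  by case: (keepP _ kj) => + _ _; apply; apply: sgT.
- apply/zero_sum_free_familyP => B BD bB.
  have bBj j : \prod_(i in B | sg i == None) w j i *
               \prod_(i in B | sg i == Some j) h j i = 1.
    transitivity (phi j (\big[op/e]_(i in B) b i)); last by rewrite bB phi1.
    rewrite phi_big. rewrite !big_mkcondr -big_split /=.
    apply: eq_bigr => i _; rewrite phiK.
    by case: (sg i) => [j'|] /=; rewrite ?mul1r ?mulr1.
  pose W := [set i in B | sg i == None].
  have W0 : W = set0.
    apply: (irreducible_tnth irr); apply: phi_inj => j.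
    rewrite /seq_prod !phi_big [RHS]big_tnth; apply: (sep j).
      by apply/subsetP=> i; rewrite !inE => /andP[_ /eqP/sgN->].
    rewrite (eq_bigl _ _ (in_set _)).
    case: (boolP (kill j)) => [/killP[_ w1 _]|/keepP[_ hp _]].
      by rewrite big1 ?mul1r.
    set p := \prod_i _.
    have hBp : \prod_(i in B | sg i == Some j) h j i * p = p.
      elim/big_rec: _ => [|i x /andP[_ /eqP/sgT iT] xp]; first by rewrite mul1r.
      by rewrite -mulrA xp hp.
    by rewrite -{1}hBp mulrA bBj mul1r.
  apply/setP=> i; rewrite inE; apply/negbTE/negP=> iB.
  have := subsetP BD i iB; rewrite inE; case sgi: (sg i) => [j|]; last first.
    have : i \in W by rewrite inE iB sgi.
    by rewrite W0 inE.
  move/keepP=> [_ _ zh].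
  pose H := [set i in B | sg i == Some j].
  have : i \in H by rewrite inE iB sgi eqxx.
  rewrite (zh H) ?inE //.
    by apply/subsetP=> k; rewrite inE => /andP[_ /eqP/sgT].
  have := bBj j; have inW i' : (i' \in W) = (i' \in B) && (sg i' == None).
    by rewrite inE.
  rewrite -(eq_bigl _ _ inW) W0 big_set0 mul1r => hB.
  by rewrite -[RHS]hB; apply: eq_bigl => k; rewrite inE.
rewrite size_map -cardE -[leqLHS]card_ord -(cardsC D) leq_add2l.
apply: (@leq_trans (\sum_(j in X) #|T j|)); last first.
  by apply: leq_sum => j; rewrite inE => /killP[].
apply: (@leq_trans #|\bigcup_(j in X) T j|).
  apply/subset_leq_card/subsetP=> i; rewrite !inE; case sgi: (sg i) => [j|//].
  by rewrite negbK => kj; apply/bigcupP; exists j; rewrite ?inE ?sgT.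
elim/big_rec2: _ => [|j n U _ IH]; first by rewrite cards0.
by apply: leq_trans (leq_card_setU _ _) _; rewrite leq_add2l.
Qed.

(** The terms of $A$ being $1$ in the component $j$, only the $r_j + 1$ new
    terms contribute to it, and $z^{r_j + 1} = 0 \ne z^{r_j}$ requires all of
    them. *)
Lemma irreducible_add_nilpotents A (j : J) :
  j \in exc -> (forall x, x \in A -> phi j x = 1) -> ~~ reducible op A ->
  exists2 A', ~~ reducible op A' & size A' = (size A + (r j).+1)%N /\
    forall i, i != j -> (forall x, x \in A -> phi i x = 1) ->
      forall x, x \in A' -> phi i x = 1.
Proof.
move=> je A1 irr; have [z [zr zr1 _ _ _]] := excK je.
pose Z := psi (dfwith (fun i => 1 : K i) z).
have Zj : phi j Z = z by rewrite phiK dfwith_in.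
have Zi i : i != j -> phi i Z = 1.
  by move=> ij; rewrite phiK dfwith_out // eq_sym.
exists (A ++ nseq (r j).+1 Z); last first.
  split; first by rewrite size_cat size_nseq.
  move=> i ij Ai x; rewrite mem_cat mem_nseq => /orP[/Ai //|/andP[_ /eqP->]].
  exact: Zi.
apply: contraNN irr => /reducibleP[_ [/subseqP[m sm ->] lt eqp]].
apply/reducibleP; move: lt eqp; rewrite -(cat_take_drop (size A) m).
have st : size (take (size A) m) = size A.
  by rewrite size_takel // sm size_cat leq_addr.
rewrite mask_cat //; set C := mask _ A; set C' := mask _ (nseq _ _).
have CA : subseq C A by apply: mask_subseq.
have [k C'E] : exists k, C' = nseq k Z.
  exists (size C'); apply/all_pred1P/allP=> x /mem_mask.
  by rewrite mem_nseq => /andP[_].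
rewrite C'E !size_cat !size_nseq => lt eqp.
have prodZ i q : phi i (seq_prod op (nseq q Z)) = phi i Z ^+ q.
  rewrite /seq_prod phi_big; elim: q => [|q IH]; rewrite ?big_nil //=.
  by rewrite big_cons IH exprS.
have prod1 i s :
    (forall x, x \in s -> phi i x = 1) -> phi i (seq_prod op s) = 1.
  by move=> s1; rewrite /seq_prod phi_big big1_seq.
have C1 x : x \in C -> phi j x = 1 by move/(mem_subseq CA)/A1.
have kr : ((r j).+1 <= k)%N.
  rewrite leqNgt; apply: contraNN zr => kr; move/(congr1 (phi j)): eqp.
  rewrite !seq_prod_cat !phiM (prod1 j A) // (prod1 j C) // !prodZ !mul1r.
  rewrite Zj zr1 => zk.
  by rewrite -ltnS in kr; rewrite -(subnK (kr : (k <= r j)%N)) exprD zk mulr0.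
exists C; split=> //.
  by rewrite -(ltn_add2r (r j).+1); apply: leq_ltn_trans lt; rewrite leq_add2l.
apply: phi_inj => i; case: (eqVneq i j) => [->|ij]; first by rewrite !prod1.
move/(congr1 (phi i)): eqp; rewrite !seq_prod_cat !phiM !prodZ Zi //.
by rewrite !expr1n !mulr1.
Qed.

Lemma irreducible_from_units (X : {set J}) A :
  X \subset exc -> (forall j x, j \in X -> x \in A -> phi j x = 1) ->
  ~~ reducible op A ->
  exists2 A', ~~ reducible op A' &
    size A' = (size A + \sum_(j in X) (r j).+1)%N.
Proof.
move=> Xe; rewrite -big_enum; have: {subset enum X <= exc}.
  by move=> j; rewrite mem_enum; apply: (subsetP Xe).
move=> sub A1; have {}A1 j x : j \in enum X -> x \in A -> phi j x = 1.
  by rewrite mem_enum; apply: A1.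
move: (enum X) (enum_uniq X) sub A1 => s; elim: s A => [|j s IH] A /=.
  by exists A; rewrite // big_nil addn0.
move=> /andP[js us] sub A1 irr.
have jexc : j \in exc by apply: sub; rewrite mem_head.
have Aj x : x \in A -> phi j x = 1 by apply: A1; rewrite mem_head.
have [A' irr' [sA' A'1]] := irreducible_add_nilpotents jexc Aj irr.
have subs : {subset s <= exc} by move=> i is_; apply: sub; rewrite inE is_ orbT.
have A's i x : i \in s -> x \in A' -> phi i x = 1.
  move=> is_; apply: A'1; first by apply: contraNneq js => <-.
  by move=> y; apply: A1; rewrite inE is_ orbT.
have [A'' irr'' sA''] := IH A' us subs A's irr'.
by exists A''; rewrite // sA'' sA' big_cons addnA.
Qed.

End ProductMonoid.

(** * Unit groups *)

Section Embedding.
Variables (S S' : finType) (e : S) (e' : S').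
Variables (op : Monoid.com_law e) (op' : Monoid.com_law e') (f : S -> S').
Hypothesis f1 : f e = e'.
Hypothesis fM : forall x y, f (op x y) = op' (f x) (f y).
Implicit Type s : seq S.

Lemma seq_prod_map s : seq_prod op' (map f s) = f (seq_prod op s).
Proof. by rewrite /seq_prod big_map (big_morph f fM f1). Qed.

Lemma irreducible_map s :
  injective f -> ~~ reducible op s -> ~~ reducible op' (map f s).
Proof.
move=> injf; apply: contraNN => /reducibleP[_ [/subseqP[m _ ->]]].
rewrite -map_mask !size_map !seq_prod_map => lt /injf eqp.
by apply/reducibleP; exists (mask m s); rewrite mask_subseq.
Qed.

Lemma zero_sum_free_map_inv s :
  zero_sum_free op' (map f s) -> zero_sum_free op s.
Proof.
move=> zs t ts t1; have := zs _ (map_subseq f ts).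
rewrite seq_prod_map t1 f1 => /(_ erefl).
by case: (t).
Qed.

End Embedding.

Lemma invertible_dffun (I : finType) (L : I -> finComPzRingType)
    (x : {dffun forall i, L i}) :
  invertible x = [forall i, invertible (x i)].
Proof.
apply/invertibleP/forallP=> [[y /ffunP yx] i|invx].
  by apply/invertibleP; exists (y i); have := yx i; rewrite !ffunE.
exists [ffun i => inverse_of (x i)]; apply/ffunP=> i; rewrite !ffunE.
exact: mul_inverse_of.
Qed.

Lemma foldr_muln_const (T : Type) (s : seq T) (F : T -> nat) :
  foldr muln 1%N [seq F x | x <- s] = (\prod_(x <- s) F x)%N.
Proof. by elim: s => [|x s IH]; rewrite ?big_nil //= big_cons IH. Qed.

Section ElementaryAbelian.
Variable m : nat.
Local Notation C2m := {dffun forall i : 'I_m, 'Z_2}.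

Lemma abelem_C2 : (2.-abelem [set: C2m])%g.
Proof.
rewrite abelemE //; apply/andP; split.
  apply/centsP=> x _ y _; apply/ffunP=> i; rewrite !ffunE.
  exact: Zp_addC.
apply/exponentP=> x _; apply/ffunP=> i; rewrite expgS expg1 !ffunE.
by case: (x i) => -[|[|//]] lt; apply: val_inj.
Qed.

Lemma card_C2 : #|[set: C2m]| = (2 ^ m)%N.
Proof.
rewrite cardsT card_dep_ffun foldr_muln_const big_enum /=.
by rewrite (eq_bigr (fun=> 2%N)) ?prod_nat_const ?card_ord.
Qed.

Lemma exponent2_parametrization (gT : finGroupType) (W : {group gT}) :
  (forall x, x \in W -> x * x = 1)%g -> #|W| = (2 ^ m)%N ->
  exists f : C2m -> gT, [/\ {morph f : x y / x * y >-> x * y}%g, injective f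
    & forall y, y \in W <-> exists x, y = f x].
Proof.
move=> W2 cW; have abW : (2.-abelem W)%g.
  rewrite abelemE //; apply/andP; split; last first.
    by apply/exponentP=> x xW; rewrite expgS expg1 W2.
  apply/centsP=> x xW y yW; rewrite /commute.
  have inv z : z \in W -> (z = z^-1)%g.
    by move=> /W2 zz; apply/eqP; rewrite eq_sym eq_invg_mul zz.
  by rewrite (inv (x * y)%g) ?groupM // invMg -!inv.
have: ([set: C2m] \isog W)%g.
  by rewrite (isog_abelem_card _ abelem_C2) abW cW card_C2 /=.
case/isogP=> f injf fW; exists f; split.
- by move=> x y; rewrite morphM ?inE.
- by move=> x y; apply: (injmP injf); rewrite ?inE.
move=> y; rewrite -fW; split=> [/morphimP[x _ _ ->]|[x ->]]; first by exists x.
by rewrite mem_morphim ?inE.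
Qed.

End ElementaryAbelian.

Section UnitsOff.
Variables (E : finType) (K : E -> finComNzRingType) (r : E -> nat).
Hypothesis excK : forall e, exceptional (K e) (r e).
Variable X : {set E}.
Local Notation U := (unit_group {dffun forall e, K e}).

Definition units_trivial_on : {set U} :=
  [set u : U | [forall e in X, val u e == 1]].

Lemma units_trivial_on_group_set : group_set units_trivial_on.
Proof.
apply/group_setP; split=> [|u v].
  by rewrite inE; apply/forall_inP=> e _; rewrite ffunE.
rewrite !inE => /forall_inP u1 /forall_inP v1; apply/forall_inP=> e eX.
by rewrite ffunE (eqP (u1 e eX)) (eqP (v1 e eX)) mulr1.
Qed.

Canonical units_trivial_on_group := Group units_trivial_on_group_set.

Lemma card_units_trivial_on :
  #|units_trivial_on| = (2 ^ \sum_(e in ~: X) r e)%N.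
Proof.
pose F e : pred (K e) :=
  fun x => if e \in X then x == 1 else invertible x.
transitivity #|(family F : simpl_pred {dffun forall e, K e})|.
  rewrite -(card_imset _ (@val_inj _ _ U)); apply: eq_card => x.
  apply/imsetP/familyP=> [[u + ->] e|xF].
    rewrite inE => /forall_inP u1; rewrite unfold_in /F.
    case: ifP => [/u1 //|_]; have := valP u; rewrite invertible_dffun.
    by move/forallP.
  have invx : invertible x.
    rewrite invertible_dffun; apply/forallP=> e; have := xF e.
    by rewrite unfold_in /F; case: ifP => // _ /eqP ->; apply: invertible1.
  exists (UnitGroup invx) => //; rewrite inE; apply/forall_inP=> e eX.
  by have := xF e; rewrite unfold_in /F eX.
rewrite card_family foldr_muln_const big_enum /= expn_sum.
rewrite big_mkcond [RHS]big_mkcond /=.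
apply: eq_bigr => e _; rewrite inE; case: (boolP (e \in X)) => eX /=.
  rewrite -(card1 (1 : K e)); apply: eq_card => x.
  by rewrite inE unfold_in /F eX.
rewrite -(exceptional_card_units (excK e)); apply: eq_card => x.
by rewrite inE unfold_in /F (negbTE eX).
Qed.

Lemma units_trivial_on_parametrization m : m = (\sum_(e in ~: X) r e)%N ->
  exists f : {dffun forall i : 'I_m, 'Z_2} -> U,
   [/\ {morph f : x y / x * y >-> x * y}%g, injective f
    & forall y, y \in units_trivial_on <-> exists x, y = f x].
Proof.
move=> ->; apply: (exponent2_parametrization (W := units_trivial_on_group)).
  move=> u _; apply/val_inj/ffunP=> e /=; rewrite !ffunE.
  apply: (exceptional_unit_square (excK e)).
  by have := valP u; rewrite invertible_dffun => /forallP.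
exact: card_units_trivial_on.
Qed.

End UnitsOff.

(** * The formula *)

Section ExceptionalFactors.
Variables (S : finType) (e : S) (op : Monoid.com_law e).
Variables (E I : finType) (KE : E -> finComNzRingType).
Variable (L : I -> finComNzRingType).

Definition factor (j : E + I) : finComNzRingType :=
  match j with inl x => KE x | inr i => L i end.

Variables (phi : forall j, S -> factor j) (psi : (forall j, factor j) -> S).
Hypothesis phi1 : forall j, phi j e = 1.
Hypothesis phiM : forall j x y, phi j (op x y) = phi j x * phi j y.
Hypothesis phi_inj : forall x y, (forall j, phi j x = phi j y) -> x = y.
Hypothesis phiK : forall f j, phi j (psi f) = f j.
Variable r : E -> nat.
Hypothesis excK : forall x, exceptional (KE x) (r x).
Hypothesis nilL : forall i, nilpotent_nonunits (L i).
Hypothesis satL : forall i, saturated (L i).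

Local Notation RL := {dffun forall i, L i}.

Let rk (j : E + I) : nat := if j is inl x then r x else 0.
Let exc : {set E + I} := [set j | if j is inl _ then true else false].
Let lift (X : {set E}) : {set E + I} :=
  [set j | if j is inl x then x \in X else false].

Let factor_nil j : nilpotent_nonunits (factor j).
Proof.
by case: j => [x|i] /=; [apply: exceptional_nilpotent (excK x) | apply: nilL].
Qed.

Let factor_exc j : j \in exc -> exceptional (factor j) (rk j).
Proof. by case: j => [x _|i]; [apply: excK | rewrite inE]. Qed.

Let factor_other j : j \notin exc -> saturated (factor j).
Proof. by case: j => [x|i _]; [rewrite inE | apply: satL]. Qed.

(** The units that are $1$ on $X$ form a copy of $U(R') \times C_2^m$. *)
Lemma units_off_parametrization (X : {set E}) m :
  m = (\sum_(x in ~: X) r x)%N ->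
  exists f : unitsxC2 RL m -> S,
   [/\ f 1%g = e, forall u v, f (u * v)%g = op (f u) (f v), injective f
     & forall x, units_off phi (lift X) x <-> exists u, x = f u].
Proof.
move=> mE; have [g [gM g_inj gP]] := units_trivial_on_parametrization excK mE.
pose f (u : unitsxC2 RL m) : S := psi (fun j => match j with
  | inl x => unit_group_val (g u.2) x
  | inr i => unit_group_val u.1 i end).
have fM u v : f (u * v)%g = op (f u) (f v).
  apply: phi_inj => -[x|i]; rewrite phiM !phiK /=; last by rewrite ffunE.
  by rewrite gM /= ffunE.
exists f; split=> //.
- have g1 : g 1%g = 1%g by apply: (mulgI (g 1%g)); rewrite -gM !mulg1.
  by apply: phi_inj => -[x|i]; rewrite phiK phi1 /= ?g1 ffunE.
- move=> [u s] [v t] /= eqf; congr (_, _).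
    apply/val_inj/ffunP=> i; have := congr1 (phi (inr i)) eqf.
    by rewrite !phiK.
  apply/g_inj/val_inj/ffunP=> x; have := congr1 (phi (inl x)) eqf.
  by rewrite !phiK.
move=> x; split=> [/forallP xP|[[u s] ->]]; last first.
  apply/forallP=> -[y|i]; rewrite phiK inE /=; last first.
    rewrite andbT; have := valP u; rewrite /= invertible_dffun.
    by move/forallP.
  have := valP (g s); rewrite /= invertible_dffun => /forallP -> /=.
  have /gP : exists t, g s = g t by exists s.
  by rewrite inE => /forallP.
have inv1 : invertible ([ffun i => phi (inr i) x] : RL).
  rewrite invertible_dffun; apply/forallP=> i; rewrite ffunE.
  by have /andP[] := xP (inr i).
have inv2 : invertible ([ffun y => phi (inl y) x] : {dffun forall y, KE y}).
  rewrite invertible_dffun; apply/forallP=> y; rewrite ffunE.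
  by have /andP[] := xP (inl y).
have /gP[s gs] : UnitGroup inv2 \in units_trivial_on KE X.
  rewrite inE; apply/forall_inP=> y yX; rewrite /= ffunE.
  by have /andP[_] := xP (inl y); rewrite inE yX.
exists (UnitGroup inv1, s); apply: phi_inj => -[y|i]; rewrite phiK /=.
  by rewrite -gs /= ffunE.
by rewrite ffunE.
Qed.

Lemma sum_lift (X : {set E}) (F : E -> nat) :
  (\sum_(j in lift X) (if j is inl x then F x else 0) = \sum_(x in X) F x)%N.
Proof.
rewrite big_sumType /= [X in (_ + X)%N]big_pred0 ?addn0 => [|i].
  by apply: eq_bigl => x; rewrite inE.
by rewrite inE.
Qed.

Lemma sum_lift_rk (X : {set E}) :
  (\sum_(j in lift X) (rk j).+1 = \sum_(x in X) (r x).+1)%N.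
Proof.
rewrite -sum_lift; apply: eq_bigr => -[x|i] //.
by rewrite inE.
Qed.

Definition unit_davenport m := davenport (S := unitsxC2 RL m) *%g.

Lemma davenport_le_factors : exists X : {set E},
  (davenport op <= unit_davenport (\sum_(x in ~: X) r x)
                     + \sum_(x in X) (r x).+1)%N.
Proof.
have [A [irr <-]] := davenport_witness op.
have [Y [B [Ye allB zB sA]]] := irreducible_to_units phi1 phiM phi_inj phiK
  factor_nil factor_exc factor_other irr.
pose X := [set x | inl x \in Y]; exists X.
have YE : Y = lift X.
  apply/setP=> -[x|i]; rewrite !inE //.
  by apply/negbTE/negP=> /(subsetP Ye); rewrite inE.
have [f [f1 fM f_inj fP]] := units_off_parametrization (X := X) erefl.
have [C BE] : exists C, B = map f C.
  elim: (B) allB => [|x s IH] /=; first by exists [::].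
  by rewrite YE => /andP[/fP[u ->]]; rewrite -YE => /IH[C ->]; exists (u :: C).
move: zB; rewrite BE => /(zero_sum_free_map_inv f1 fM) zC.
apply: leq_ltn_trans sA _; rewrite YE sum_lift_rk -addSn leq_add2r BE size_map.
rewrite /unit_davenport; apply: davenport_gt.
exact: (@zero_sum_free_irreducible (unitsxC2 RL _) *%g C
  (fun _ _ => erefl) zC).
Qed.

Lemma davenport_ge_factors (X : {set E}) :
  (unit_davenport (\sum_(x in ~: X) r x) + \sum_(x in X) (r x).+1
     <= davenport op)%N.
Proof.
rewrite /unit_davenport; set m := (\sum_(x in ~: X) r x)%N.
have [C [irrC <-]] := davenport_witness (S := unitsxC2 RL m) *%g.
have [f [f1 fM f_inj fP]] := units_off_parametrization (X := X) erefl.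
have irr := irreducible_map (op' := op) f1 fM f_inj irrC.
have sub : lift X \subset exc by apply/subsetP=> -[x|i]; rewrite !inE.
have f_lift j x : j \in lift X -> x \in map f C -> phi j x = 1.
  move=> jX /mapP[u _ ->].
  have /fP/forallP/(_ j)/andP[_] : exists v, f u = f v by exists u.
  by rewrite jX => /eqP.
have [A irrA sA] :=
  irreducible_from_units phi1 phiM phi_inj phiK factor_exc sub f_lift irr.
rewrite addSn; have := davenport_gt irrA.
by rewrite sA size_map sum_lift_rk.
Qed.

End ExceptionalFactors.

Lemma exists_set_card (T : finType) a :
  (a <= #|T|)%N -> exists A : {set T}, #|A| = a.
Proof.
move=> aT; exists [set x in take a (enum T)].
rewrite cardsE (card_uniqP _) ?take_uniq ?enum_uniq //.
by rewrite size_takel // -cardE.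
Qed.

Section ExceptionalIndices.
Variables k1 k2 k3 k4 : nat.

(** $\mathbb Z/4$ and $\mathbb F_2[x]/(x^2)$ are grouped because the parameter
    $a$ counts the components of both kinds together. *)
Definition exc_index : finType := ('I_k1 + ('I_k2 + 'I_k4) + 'I_k3)%type.

Definition exc_ring (x : exc_index) : finComNzRingType :=
  match x with
  | inl (inl _) => 'Z_2
  | inl (inr (inl _)) => 'Z_4
  | inl (inr (inr _)) => F2_dual
  | inr _ => 'Z_8
  end.

Definition exc_length (x : exc_index) : nat :=
  match x with inl (inl _) => 0 | inl (inr _) => 1 | inr _ => 2 end.

Lemma exc_ringP x : exceptional (exc_ring x) (exc_length x).
Proof.
case: x => [[i|[i|i]]|i] /=.
- exact: exceptional_Z2.
- exact: exceptional_Z4.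
- exact: exceptional_F2_dual.
- exact: exceptional_Z8.
Qed.

Lemma sum_exc_index (F : nat -> nat) (X : {set exc_index}) :
  (\sum_(x in X) F (exc_length x) =
     #|[set i | inl (inl i) \in X]| * F 0 +
     #|[set i | inl (inr i) \in X]| * F 1 + #|[set i | inr i \in X]| * F 2)%N.
Proof.
by rewrite 2!big_sumType /=; congr (_ + _ + _)%N; rewrite -sum_nat_const;
  apply: eq_bigl => i; rewrite inE.
Qed.

End ExceptionalIndices.

Theorem theorem3p2 (k1 k2 k3 k4 n : nat) (L : 'I_n -> finComNzRingType)
    (R : finComPzRingType)
    (L_local : forall i, local_ring (L i))
    (L_other : forall i, [/\ ~ ring_isomorphic (L i) 'Z_2,
                             ~ ring_isomorphic (L i) 'Z_4,
                             ~ ring_isomorphic (L i) 'Z_8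
                           & ~ ring_isomorphic (L i) F2_dual])
    (R_form : ring_isomorphic R
       ({ffun 'I_k1 -> 'Z_2} * {ffun 'I_k2 -> 'Z_4} * {ffun 'I_k3 -> 'Z_8} *
        {ffun 'I_k4 -> F2_dual} * {dffun forall i : 'I_n, L i})%type) :
  davenport (S := R) *%R =
    \max_(a < (k2 + k4).+1) \max_(b < k3.+1)
      (davenport (S := unitsxC2 {dffun forall i : 'I_n, L i}
                               (k2 + k4 + 2 * k3 - a - 2 * b)) *%g
       + k1 + 2 * a + 3 * b)%N.
Proof.
have nilL i : nilpotent_nonunits (L i) by apply: local_nilpotent_nonunits.
have satL i : saturated (L i) by apply: other_local_saturated.
case: R_form => f [g fK gK].
pose fac := factor (exc_ring (k1 := k1) (k2 := k2) (k3 := k3) (k4 := k4)) L.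
pose phi (j : exc_index k1 k2 k3 k4 + 'I_n) (x : R) : fac j :=
  match j return fac j with
  | inl (inl (inl i)) => (f x).1.1.1.1 i
  | inl (inl (inr (inl i))) => (f x).1.1.1.2 i
  | inl (inl (inr (inr i))) => (f x).1.2 i
  | inl (inr i) => (f x).1.1.2 i
  | inr i => (f x).2 i
  end.
pose psi (y : forall j, fac j) : R :=
  g ([ffun i => y (inl (inl (inl i)))], [ffun i => y (inl (inl (inr (inl i))))],
     [ffun i => y (inl (inr i))], [ffun i => y (inl (inl (inr (inr i))))],
     [ffun i => y (inr i)]).
have phi1 j : phi j 1 = 1.
  by case: j => [[[i|[i|i]]|i]|i]; rewrite /phi rmorph1 /= ffunE.
have phiM j x y : phi j (x * y) = phi j x * phi j y.
  by case: j => [[[i|[i|i]]|i]|i]; rewrite /phi rmorphM /= ffunE.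
have phiK y j : phi j (psi y) = y j.
  by case: j => [[[i|[i|i]]|i]|i]; rewrite /phi gK /= ffunE.
have phi_inj x y : (forall j, phi j x = phi j y) -> x = y.
  move=> exy; apply: (can_inj fK).
  move: {exy} (fun i => exy (inl (inl (inl i))))
    (fun i => exy (inl (inl (inr (inl i))))) (fun i => exy (inl (inr i)))
    (fun i => exy (inl (inl (inr (inr i))))) (fun i => exy (inr i)).
  rewrite /phi; move: (f x) (f y).
  move=> [[[[x1 x2] x3] x4] x5] [[[[y1 y2] y3] y4] y5] /= e1 e2 e3 e4 e5.
  by congr (_, _, _, _, _); apply/ffunP.
pose D m := davenport (S := unitsxC2 {dffun forall i : 'I_n, L i} m) *%g.
pose a_ (X : {set exc_index k1 k2 k3 k4}) := #|[set i | inl (inr i) \in X]|.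
pose b_ (X : {set exc_index k1 k2 k3 k4}) := #|[set i | inr i \in X]|.
have a_le X : (a_ X <= k2 + k4)%N.
  by rewrite -[X in (_ <= X + _)%N]card_ord -[X in (_ <= _ + X)%N]card_ord
    -card_sum max_card.
have b_le X : (b_ X <= k3)%N by rewrite -[leqRHS]card_ord max_card.
have rank X : (\sum_(x in ~: X) exc_length x
    = k2 + k4 + 2 * k3 - a_ X - 2 * b_ X)%N.
  have cC (T : finType) (h : T -> exc_index k1 k2 k3 k4) :
    #|[set i | h i \in ~: X]| = (#|T| - #|[set i | h i \in X]|)%N.
    rewrite -(cardsC [set i | h i \in X]) addKn; apply: eq_card => i.
    by rewrite !inE.
  rewrite (sum_exc_index id) !cC card_sum !card_ord -/(a_ X) -/(b_ X).
  by have := a_le X; have := b_le X; lia.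
have sum_lengths (X : {set exc_index k1 k2 k3 k4}) :
  (\sum_(x in X) (exc_length x).+1
    = #|[set i | inl (inl i) \in X]| + 2 * a_ X + 3 * b_ X)%N.
  by rewrite (sum_exc_index succn) -/(a_ X) -/(b_ X); lia.
apply/eqP; rewrite eqn_leq; apply/andP; split.
  have [X] := davenport_le_factors phi1 phiM phi_inj phiK
    (@exc_ringP k1 k2 k3 k4) nilL satL.
  rewrite rank sum_lengths /unit_davenport => /leq_trans -> //.
  apply: leq_trans (leq_bigmax (Ordinal (a_le X : a_ X < (k2 + k4).+1)%N)).
  apply: leq_trans (leq_bigmax (Ordinal (b_le X : b_ X < k3.+1)%N)).
  (* The set $X$ may miss some components $\mathbb Z/2$, which only lowers its
     contribution. *)
  rewrite /= -!addnA leq_add2l !addnA !leq_add2r.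
  by rewrite -[leqRHS]card_ord max_card.
apply/bigmax_leqP=> a _; apply/bigmax_leqP=> b _.
have [A cA] : exists A : {set 'I_k2 + 'I_k4}, #|A| = a.
  by apply: exists_set_card; rewrite card_sum !card_ord -ltnS.
have [B cB] : exists B : {set 'I_k3}, #|B| = b.
  by apply: exists_set_card; rewrite card_ord -ltnS.
pose X : {set exc_index k1 k2 k3 k4} :=
  [set x | match x with
           | inl (inl _) => true | inl (inr i) => i \in A | inr i => i \in B
           end].
have aX : a_ X = a by rewrite -cA; apply: eq_card => i; rewrite !inE.
have bX : b_ X = b by rewrite -cB; apply: eq_card => i; rewrite !inE.
have cX : #|[set i | inl (inl i) \in X]| = k1.
  by rewrite -[RHS]card_ord; apply: eq_card => i; rewrite !inE.
have := davenport_ge_factors phi1 phiM phi_inj phiK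
  (@exc_ringP k1 k2 k3 k4) X.
by rewrite rank sum_lengths aX bX cX !addnA.
Qed.
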